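(* Let $q,\beta\in(0,1)$, and let $S^r_n$, $(n,r)\in\mathbb{Z}^2$, be i.i.d. random variables with distribution $\mathrm{Ber}(q)\mathrm{Geom}(\beta)$. For $x>0$ let $f(x)$ be the time constant of the directed first-passage percolation model with these weights, i.e. the almost sure limit $$f(x)=\lim_{N\to\infty}\frac1N F\big((0,0),(\lfloor xN\rfloor,N)\big),$$ where $F$ is the first-passage time defined in the context. Then for every $x>0$ $$f(x)=\frac{1}{\beta q}\sup_{p\in(0,q)}\left\{\frac{p\big[p(1-q)+(q-p)\beta\big]}{1-p}\left[x-\frac{1-q}{q-p}\right]\right\},$$ or alternatively $$f(x)=\beta\sup_{\alpha\in(\beta,1)}\frac{1-\alpha}{\alpha}\left[\frac{qx}{\alpha(1-\beta-q)+\beta q}-\frac{1}{\alpha-\beta}\right].$$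
   Context: A random variable $S$ has distribution $\mathrm{Ber}(q)\mathrm{Geom}(\beta)$ if $\mathbb{P}(S=0)=1-q$ and $\mathbb{P}(S=k)=q\beta(1-\beta)^{k-1}$ for integers $k\ge1$. For $(i,j)\le(k,l)$ in $\mathbb{Z}^2$ (coordinatewise), $\Pi((i,j),(k,l))$ is the set of directed paths $(i,r_1),(i+1,r_2),\dots,(k,r_{k-i+1})$ with integers $j\le r_1\le r_2\le\dots\le r_{k-i+1}\le l$ (strictly increasing, by unit steps, in the first coordinate and weakly increasing in the second). The weight of a path $\gamma$ is $S(\gamma)=\sum_{(n,r)\in\gamma}S^r_n$, and the first-passage time is $$F\big((i,j),(k,l)\big)=\min_{\gamma\in\Pi((i,j),(k,l))}S(\gamma).$$ The almost sure limit defining $f(x)$ exists and is constant by Kingman's subadditive ergodic theorem. *)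

(* Defs.v *)
From HB Require Import structures.
From mathcomp Require Import all_boot all_order all_algebra.
From mathcomp Require Import all_classical all_reals all_analysis.

Set Implicit Arguments.
Unset Strict Implicit.
Unset Printing Implicit Defensive.

Import Order.TTheory GRing.Theory Num.Theory.
Import numFieldNormedType.Exports.

Local Open Scope classical_set_scope.
Local Open Scope ring_scope.

(* The site (n, r) carries the weight S^r_n. *)
Notation site := (int * int)%type.

(* Paths are listed by increasing first coordinate, which takes each of the
   values a.1, a.1 + 1, ..., b.1 exactly once (`|b.1 - a.1|%N is b.1 - a.1 when
   a <= b).  The second coordinate may jump between consecutive columns. *)
Definition directed_path (a b : site) (g : seq site) : bool :=
  [&& [seq v.1 | v <- g] == [seq a.1 + m%:Z | m <- iota 0 `|b.1 - a.1|%N.+1],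
      sorted <=%R [seq v.2 | v <- g]
    & all (fun r : int => a.2 <= r <= b.2) [seq v.2 | v <- g] ].

Section first_passage.
Context {R : realType}.
Implicit Types (s : site -> R) (a b : site) (g : seq site).

Definition path_weight s g : R := \sum_(v <- g) s v.

(* For a <= b there are finitely many paths, and at least one, so that this
   infimum is a minimum: see fpt_min. *)
Definition fpt s a b : R :=
  inf [set path_weight s g | g in [set g | directed_path a b g]].

Let finite_seqs (A : set int) (n : nat) : finite_set A ->
  finite_set [set t : seq int | size t = n /\ forall r, r \in t -> A r].
Proof.
move=> finA; elim: n => [|n IH].
  apply: (@sub_finite_set _ _ [set [::]]); last exact: finite_set1.
  by move=> t /= [/size0nil].
have := finite_image (fun u : int * seq int => u.1 :: u.2) (finite_setX finA IH).
apply: sub_finite_set => -[|r t] /= [] // [tn] tA.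
exists (r, t) => //; split; first by apply: tA; rewrite mem_head.
by split=> // r' r't; apply: tA; rewrite inE r't orbT.
Qed.

Let finite_paths a b : finite_set [set g | directed_path a b g].
Proof.
set n := `|b.1 - a.1|%N.+1.
have finA : finite_set [set r : int | a.2 <= r <= b.2].
  have := finite_image (fun m : nat => a.2 + m%:Z)
    (finite_II `|b.2 - a.2|%N.+1).
  apply: sub_finite_set => r /= /andP[ar rb].
  exists `|r - a.2|%N; last by rewrite /= gez0_abs ?subr_ge0// subrKC.
  rewrite /= ltnS -lez_nat !gez0_abs ?subr_ge0 ?(le_trans ar)//.
  by rewrite lerD2r.
have := finite_image (zip [seq a.1 + m%:Z | m <- iota 0 n]) (finite_seqs n finA).
apply: sub_finite_set => g /= /and3P[/eqP g1 _ /allP g2].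
exists [seq v.2 | v <- g]; last by have := zip_unzip g; rewrite /unzip1 g1.
split; last exact: g2.
by have /(congr1 size) := g1; rewrite !size_map size_iota.
Qed.

Lemma fpt_min s a b : a.1 <= b.1 -> a.2 <= b.2 ->
  (exists2 g, directed_path a b g & fpt s a b = path_weight s g) /\
  (forall g, directed_path a b g -> fpt s a b <= path_weight s g).
Proof.
move=> ab1 ab2.
set W := [set path_weight s g | g in [set g | directed_path a b g]].
have finW : finite_set W by apply: finite_image; exact: finite_paths.
have W0 : W !=set0.
  pose g0 : seq site :=
    [seq (a.1 + m%:Z, a.2) | m <- iota 0 `|b.1 - a.1|%N.+1].
  exists (path_weight s g0), g0 => //=; apply/and3P; split.
  - by rewrite -map_comp; apply/eqP/eq_map.
  - rewrite -map_comp; have -> : (snd \o fun m : nat => (a.1 + m%:Z, a.2)) =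
      (fun=> a.2) by [].
    by elim: (iota _ _) => //= _ [|m t] //= ->; rewrite lexx.
  - by apply/allP => r /mapP[v /mapP[m _ ->] ->] /=; rewrite lexx ab2.
have [m Wm mW] : exists2 m, W m & forall w, W w -> m <= w.
  have [t Wt] := (finite_seqP W).1 finW; rewrite Wt in W0 *.
  elim: t {Wt} W0 => [[w]|u t IH _] /=; first by rewrite in_nil.
  have [->|t0] := eqVneq t [::].
    by exists u => [|w] /=; rewrite !inE// => /eqP ->.
  have [|m /= mt mmin] := IH.
    by case: t t0 {IH} => // v t _; exists v; rewrite /= mem_head.
  have [um|mu] := leP u m.
    exists u => [|w] /=; rewrite !inE ?eqxx// => /predU1P[->//|wt].
    exact: le_trans um (mmin _ wt).
  exists m => [|w] /=; rewrite !inE ?mt ?orbT// => /predU1P[->|/mmin//].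
  exact: ltW.
have fE : fpt s a b = m.
  apply/le_anti/andP; split; first by apply: ge_inf => //; exists m.
  exact: lb_le_inf.
by rewrite fE; split=> [|g gab]; [case: Wm => g gab <-; exists g|apply: mW; exists g].
Qed.

End first_passage.

Section random_weights.
Context d (T : measurableType d) (R : realType) (P : probability T R).

Definition ber_geom (q beta : R) (X : {RV P >-> R}) : Prop :=
  P [set w | X w = 0] = (1 - q)%:E /\
  forall k : nat, (1 <= k)%N ->
    P [set w | X w = k%:R] = (q * beta * (1 - beta) ^+ (k - 1))%:E.

Definition mutually_independent (I : eqType) (X : I -> {RV P >-> R}) : Prop :=
  forall (J : seq I) (A : I -> set R), uniq J ->
    (forall i, measurable (A i)) ->
    P [set w | forall i, i \in J -> A i (X i w)] =
    (\prod_(i <- J) P [set w | A i (X i w)])%E.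

(* l is the almost sure limit of F((0,0), (floor (x N), N)) / N. *)
Definition is_time_constant (S : site -> {RV P >-> R}) (x l : R) : Prop :=
  {ae P, forall w,
    (N%:R^-1 * fpt (fun v => S v w) (0, 0) (Num.floor (x * N%:R), N%:Z))
      @[N --> \oo] --> l}.

End random_weights.

(* Main.v *)
Require Import Defs.
From HB Require Import structures.
From mathcomp Require Import all_boot all_order all_algebra.
From mathcomp Require Import all_classical all_reals all_analysis.
From mathcomp Require Import zify ring lra.
Set Implicit Arguments.
Unset Strict Implicit.
Unset Printing Implicit Defensive.
Import Order.TTheory GRing.Theory Num.Theory.
Import numFieldNormedType.Exports.
Local Open Scope classical_set_scope.
Local Open Scope ring_scope.

(** A function on the lattice satisfying the first-passage recursion
      G (k, l) = min (G (k, l - 1)) (G (k - 1, l) + S k l)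
    is a tandem of queues: its horizontal increments along row l - 1 are the
    arrivals, and along row l the departures, of a queue with services S _ l,
    whose lengths are the vertical decrements.  For every alpha in (beta, 1)
    there are Bernoulli-geometric boundary values, with means A and B, which
    are stationary for this recursion (Burke property), so that G grows like
    N (x A - B) with exponentially small deviations.  A directed path from the
    corner competes in the minimum defining G, hence F >= G and
    f x >= x A - B for every alpha.

    Conversely G is attained by a path leaving the boundary somewhere.  At an
    interior maximizer of x A - B, changing alpha by h changes x A - B by
    o(h), whereas the lower bound with the changed parameter makes an exit at
    distance delta N dearer by an amount of order h delta N; so the exit is
    near the corner and F <= G + o(N).  When x <= (1 - q) / q there is no
    interior maximizer and f x = 0 follows from the monotonicity of F in the
    number of columns.  The exponential bounds and the Borel-Cantelli lemma
    replace the subadditive ergodic theorem.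

    The given probability space need not carry the boundary values: estimates
    are proved for product laws on sequences of naturals, represented by their
    expectation functionals, and only the resulting bounds on events of the
    weights are transferred back. *)

(** * Tandem queues and directed paths *)

Section queues.
Local Open Scope nat_scope.
Implicit Types (a c i j n : nat) (us ss : seq nat) (rows : seq (seq nat)).
Implicit Types xs : seq (nat * seq nat).

(* One queue fed with arrivals us and services ss, starting from a waiting
   customers: the departures and the final queue length.  The truncated
   subtraction a + u - s is the number of customers left. *)
Fixpoint queue a us ss : seq nat * nat :=
  match us, ss with
  | u :: us', s :: ss' =>
      let r := queue (a + u - s) us' ss' in (minn (a + u) s :: r.1, r.2)
  | _, _ => ([::], a)
  end.

(* Each x in xs holds the initial queue length and the services of one row; the
   departures of a row are the arrivals of the next one. *)
Fixpoint tandem us xs : seq nat :=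
  if xs is x :: xs' then tandem (queue x.1 us x.2).1 xs' else us.

(* Some directed path through columns i, .., n - 1 of the rectangle rows, listed
   from the bottom row, has weight c; j is the column where it leaves the
   bottom row. *)
Fixpoint reach rows n i c : Prop :=
  if rows is ss :: rows' then
    exists j c', [/\ i <= j <= n, reach rows' n j c' &
                  c = sumn (drop i (take j ss)) + c']
  else i = n /\ c = 0.

Lemma sumn_take_drop i ss : sumn (take i ss) + sumn (drop i ss) = sumn ss.
Proof. by rewrite -sumn_cat cat_take_drop. Qed.

Lemma sumn_take_split i j ss : i <= j ->
  sumn (take j ss) = sumn (take i ss) + sumn (drop i (take j ss)).
Proof. by move=> ij; rewrite -(sumn_take_drop i (take j ss)) take_takel. Qed.

Lemma size_queue a us ss : size us = size ss -> size (queue a us ss).1 = size us.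
Proof. by elim: us a ss => [|u us IH] a [|s ss] //= [/IH ->]. Qed.

Lemma queue_le_arrivals a us ss i : size us = size ss ->
  sumn (take i (queue a us ss).1) <= a + sumn (take i us).
Proof.
elim: us a ss i => [|u us IH] a [|s ss] [|i] //= [/IH h].
by have := h (a + u - s) i; lia.
Qed.

Lemma queue_le_services a us ss i j : size us = size ss ->
  sumn (drop i (take j (queue a us ss).1)) <= sumn (drop i (take j ss)).
Proof.
elim: us a ss i j => [|u us IH] a [|s ss] [|i] [|j] //= [/IH h]; last exact: h.
by have := h (a + u - s) 0 j; rewrite !drop0; lia.
Qed.

(** Take for [j] the end of the last column whose service exceeds the customers present: all who
    arrived up to then have left, and every later service is used in full. If there is no such
    column, all services are used. *)
Lemma queue_ge a us ss i : size us = size ss -> i <= size us ->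
  sumn (take i ss) <= sumn (take i (queue a us ss).1) \/
  exists2 j, j <= i &
    a + sumn (take j us) + sumn (drop j (take i ss)) <=
    sumn (take i (queue a us ss).1).
Proof.
elim: us a ss i => [|u us IH] a [|s ss] [|i] //=; try by left.
move=> [sz] ilt; have [h|[j ji h]] := IH (a + u - s) ss i sz ilt.
  have [sau|aus] := leqP s (a + u); [left; lia|right].
  by exists 1 => //=; rewrite take0 drop0 /=; lia.
by right; exists j.+1 => //=; lia.
Qed.

Lemma reach_le rows n i c : reach rows n i c -> i <= n.
Proof. by case: rows => [[->]|ss rows [j [c' [/andP[ij jn] _ _]]]] //=; lia. Qed.

(** With [G] zero at the lower left corner, [sumn (tandem us xs) - sumn (unzip1 xs)] is its value at
    the upper right one. A path leaving the bottom boundary after column [i] competes in this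
    minimum: in each row the departures are bounded by the arrivals before the path enters the row,
    and by the services while it stays there. *)
Lemma tandem_le_reach us xs n i c : size us = n ->
  all (fun x => size x.2 == n) xs -> reach (unzip2 xs) n i c ->
  sumn (tandem us xs) <= sumn (take i us) + c + sumn (unzip1 xs).
Proof.
elim: xs us i c => [|[v ss] xs IH] us i c usn /=.
  by move=> _ [-> ->]; rewrite -usn take_size; lia.
move=> /andP[/eqP ssn xsn] [j [c' [/andP[ij jn] r ->]]].
have uss : size us = size ss by rewrite usn.
have szq : size (queue v us ss).1 = n by rewrite size_queue.
have := IH _ _ _ szq xsn r.
rewrite (sumn_take_split _ ij).
have := queue_le_arrivals v i uss; have := queue_le_services v i j uss; lia.
Qed.

(* The minimizing path leaves the boundary either from the bottom, after column
   i, or from the left, in row m. *)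
Lemma tandem_ge_reach us xs n : size us = n ->
  all (fun x => size x.2 == n) xs ->
  (exists i c, reach (unzip2 xs) n i c /\
    sumn (take i us) + c + sumn (unzip1 xs) <= sumn (tandem us xs)) \/
  (exists m c, [/\ m < size xs, reach (drop m (unzip2 xs)) n 0 c &
    c + sumn (unzip1 xs) <= sumn (tandem us xs) + sumn (take m.+1 (unzip1 xs))]).
Proof.
elim: xs us => [|[v ss] xs IH] us usn /=.
  by move=> _; left; exists n, 0; rewrite -usn take_size; split => //; lia.
move=> /andP[/eqP ssn xsn].
have uss : size us = size ss by rewrite usn.
have szq : size (queue v us ss).1 = n by rewrite size_queue.
have [[i [c [r le]]]|[m [c [mx r le]]]] := IH _ szq xsn; last first.
  by right; exists m.+1, c; split => //=; move: le => /=; lia.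
have iN := reach_le r.
have [|h|[j ji h]] := @queue_ge v us ss i uss; first by rewrite usn.
  right; exists 0, (sumn (take i ss) + c); split => //=.
    by exists i, c; rewrite drop0 iN.
  by rewrite take0 /=; lia.
left; exists j, (sumn (drop j (take i ss)) + c); split; last lia.
by exists i, c; rewrite ji iN.
Qed.

Lemma reach_from_left ss rows n i c : reach (ss :: rows) n i c ->
  reach (ss :: rows) n 0 (sumn (take i ss) + c).
Proof.
move=> [j [c' [/andP[ij jn] r ->]]]; exists j, c'; split => //.
by rewrite drop0 (sumn_take_split _ ij); lia.
Qed.

(** The path climbs past the first [m] rows before column 0, where it collects no weight. *)
Lemma reach_from_bottom rows n m c :
  reach (drop m rows) n 0 c -> reach rows n 0 c.
Proof.
elim: m rows => [|m IH] [|ss rows] //= /IH r.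
by exists 0, c; rewrite take0.
Qed.

Lemma reach_drop rows n i j c : reach rows n (i + j) c ->
  reach (map (drop i) rows) (n - i) j c.
Proof.
elim: rows j c => [|ss rows IH] j c /=; first by move=> [<- ->]; split => //; lia.
move=> [l [c' [/andP[ijl ln] r ->]]]; exists (l - i), c'; split; first lia.
  by apply: IH; rewrite subnKC //; lia.
congr (_ + _); rewrite take_drop drop_drop subnK; last lia.
by rewrite addnC.
Qed.

(** Cutting a path after column [n] only drops nonnegative weights; this is the source of
    monotonicity in the number of columns. *)
Lemma reach_take rows n n' i c : n <= n' -> reach rows n' i c ->
  exists2 c', c' <= c & reach (map (take n) rows) n (minn i n) c'.
Proof.
move=> nn'; elim: rows i c => [|ss rows IH] i c /=.
  by move=> [-> ->]; exists 0 => //; split => //; lia.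
move=> [j [c' [/andP[ij jn] r ->]]]; have [c'' le r'] := IH _ _ r.
exists (sumn (drop (minn i n) (take (minn j n) (take n ss))) + c'').
  apply: leq_add => //; rewrite take_takel ?geq_minr//.
  have [ni|ni] := leqP n i.
    have -> : minn j n = n by lia.
    by rewrite drop_oversize // size_take_min; lia.
  rewrite -(@sumn_take_drop (minn j n - i) (drop i (take j ss))) take_drop.
  by rewrite subnK ?take_takel ?leq_addr//; lia.
by exists (minn j n), c''; split => //; lia.
Qed.

End queues.

(** * Laws as expectation functionals *)

Section laws.
Context {R : realType}.
Local Open Scope ereal_scope.

(* Only the values at nonnegative functions are meaningful.  Countable additivity
   is required of all such functions, so these are the discrete laws. *)
Record law (X : Type) := Law {
  expect :> (X -> \bar R) -> \bar R;
  expect1 : expect (fun=> 1) = 1;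
  expect_le : forall f g, (forall x, 0 <= f x) -> (forall x, f x <= g x) ->
    expect f <= expect g;
  expectZ : forall c f, (0 <= c)%R -> (forall x, 0 <= f x) ->
    expect (fun x => c%:E * f x) = c%:E * expect f;
  expectD : forall f g, (forall x, 0 <= f x) -> (forall x, 0 <= g x) ->
    expect (fun x => f x + g x) = expect f + expect g;
  expect_series : forall f : nat -> X -> \bar R, (forall k x, 0 <= f k x) ->
    expect (fun x => \sum_(k <oo) f k x) = \sum_(k <oo) expect (f k) }.

Lemma eq_expect X (L : law X) f g : f =1 g -> L f = L g.
Proof. by move=> /funext ->. Qed.

Lemma expect0 X (L : law X) : L (fun=> 0) = 0.
Proof.
have := @expectZ _ L 0%R (fun=> 1) (lexx _) (fun=> lee01).
rewrite [X in _ = X]mul0e; apply: etrans.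
by apply: eq_expect => x; rewrite mul0e.
Qed.

Lemma expect_ge0 X (L : law X) f : (forall x, 0 <= f x) -> 0 <= L f.
Proof. by move=> f0; rewrite -(expect0 L); apply: expect_le. Qed.

Lemma expect_cst X (L : law X) c : 0 <= c -> L (fun=> c) = c.
Proof.
have fin (r : R) : (0 <= r)%R -> L (fun=> r%:E) = r%:E.
  move=> r0; have := @expectZ _ L r (fun=> 1) r0 (fun=> lee01).
  by rewrite expect1 mule1.
case: c => [r||//]; first by rewrite lee_fin; exact: fin.
move=> _; apply/eqyP => r r0.
by rewrite -(fin _ (ltW r0)); apply: expect_le => x; rewrite ?leey ?lee_fin ?ltW.
Qed.

(** Tonelli's theorem for [L] against an arbitrary law. It holds for [disc], which is a series that
    [expect_series] carries through the other law. *)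
Definition swaps X (L : law X) := forall Y (M : law Y) (f : X -> Y -> \bar R),
  (forall x y, 0 <= f x y) ->
  L (fun x => M (f x)) = M (fun y => L (f ^~ y)).

Section disc.
Variables (w : nat -> R).
Hypotheses (w0 : forall k, (0 <= w k)%R) (w1 : \sum_(k <oo) (w k)%:E = 1).

Program Definition disc : law nat :=
  @Law nat (fun f => \sum_(k <oo) (w k)%:E * f k) _ _ _ _ _.
Next Obligation.
by rewrite -[RHS]w1; apply: eq_eseriesr => k _; rewrite mule1.
Qed.
Next Obligation.
move=> f g f0 fg; apply: lee_nneseries => k *; first by rewrite mule_ge0 ?lee_fin.
by rewrite lee_wpmul2l ?lee_fin.
Qed.
Next Obligation.
move=> c f c0 f0; rewrite -nneseriesZl; last first.
  by move=> k _; rewrite mule_ge0 ?lee_fin.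
by apply: eq_eseriesr => k _; rewrite muleCA.
Qed.
Next Obligation.
move=> f g f0 g0.
rewrite -nneseriesD; try by move=> k *; rewrite mule_ge0 ?lee_fin.
by apply: eq_eseriesr => k _; rewrite ge0_muleDr.
Qed.
Next Obligation.
move=> f f0.
rewrite -nneseries_interchange; last by move=> i j; rewrite mule_ge0 ?lee_fin.
by apply: eq_eseriesr => k _; rewrite nneseriesZl.
Qed.

Lemma swaps_disc : swaps disc.
Proof.
move=> Y M f f0 /=; rewrite expect_series; last first.
  by move=> k y; rewrite mule_ge0 ?lee_fin.
by apply: eq_eseriesr => k _; rewrite expectZ.
Qed.

End disc.

Definition ret X (x : X) : law X :=
  @Law X (fun f => f x) erefl (fun f g _ fg => fg x) (fun c f _ _ => erefl)
    (fun _ _ _ _ => erefl) (fun _ _ => erefl).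

Program Definition bind X Y (L : law X) (K : X -> law Y) : law Y :=
  @Law Y (fun f => L (fun x => K x f)) _ _ _ _ _.
Next Obligation.
move=> X Y L K; rewrite -[RHS](expect1 L).
by apply: eq_expect => x; exact: expect1.
Qed.
Next Obligation.
move=> X Y L K f g f0 fg; apply: expect_le => x; first exact: expect_ge0.
exact: expect_le.
Qed.
Next Obligation.
move=> X Y L K c f c0 f0; rewrite -expectZ//; last by move=> x; exact: expect_ge0.
by apply: eq_expect => x; exact: expectZ.
Qed.
Next Obligation.
move=> X Y L K f g f0 g0.
rewrite -expectD//; try by move=> x; exact: expect_ge0.
by apply: eq_expect => x; exact: expectD.
Qed.
Next Obligation.
move=> X Y L K f f0.
rewrite -expect_series//; last by move=> k x; exact: expect_ge0.
by apply: eq_expect => x; exact: expect_series.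
Qed.

Definition prodl X Y (L : law X) (M : law Y) : law (X * Y) :=
  bind L (fun x => bind M (fun y => ret (x, y))).

Fixpoint iid X (L : law X) n : law (seq X) :=
  if n is n'.+1 then bind L (fun x => bind (iid L n') (fun xs => ret (x :: xs)))
  else ret [::].

Lemma iid_cat X (L : law X) m n f :
  iid L (m + n) f = iid L m (fun xs => iid L n (fun ys => f (xs ++ ys))).
Proof.
elim: m f => [//|m IH] f; rewrite addSn /=.
by apply: eq_expect => x; rewrite IH.
Qed.

Lemma iid_map X Y (L : law X) (M : law Y) (g : X -> Y) :
  (forall f, (forall y, 0 <= f y) -> L (fun x => f (g x)) = M f) ->
  forall n f, (forall ys, 0 <= f ys) ->
    iid L n (fun xs => f (map g xs)) = iid M n f.
Proof.
move=> LM; elim=> [//|n IH] f f0 /=.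
rewrite -LM => [|y]; last exact: expect_ge0.
by apply: eq_expect => x; rewrite -IH.
Qed.

Lemma iid_drop X (L : law X) i n f : (i <= n)%N -> (forall x, 0 <= f x) ->
  iid L n (fun xs => f (drop i xs)) = iid L (n - i) f.
Proof.
move=> + f0; elim: i n => [|i IH] n.
  by move=> _; rewrite subn0; apply: eq_expect => xs; rewrite drop0.
case: n => // n ni.
by rewrite /= IH// expect_cst// expect_ge0.
Qed.

Lemma iid_take X (L : law X) i n f : (i <= n)%N -> (forall x, 0 <= f x) ->
  iid L n (fun xs => f (take i xs)) = iid L i f.
Proof.
elim: i n f => [|i IH] n f.
  move=> _ f0; rewrite -[RHS](@expect_cst _ (iid L n))//; last exact: f0.
  by apply: eq_expect => xs; rewrite take0.
case: n => // n ni f0 /=; apply: eq_expect => x.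
by rewrite (IH _ (fun xs => f (x :: xs))).
Qed.

(* One-sided formulation of being supported by A, which composes under bind. *)
Definition carried X (L : law X) (A : pred X) := forall f g,
  (forall x, 0 <= f x) -> (forall x, A x -> f x <= g x) -> L f <= L g.

Lemma carriedT X (L : law X) : carried L predT.
Proof. by move=> f g f0 fg; apply: expect_le => // x; apply: fg. Qed.

Lemma carried_prodl X Y (L : law X) (M : law Y) A B :
  carried L A -> carried M B ->
  carried (prodl L M) (fun z => A z.1 && B z.2).
Proof.
move=> LA MB f g f0 fg /=; apply: LA => [x|x Ax]; first exact: expect_ge0.
by apply: MB => // y By; apply: fg; rewrite /= Ax.
Qed.

Lemma carried_iid X (L : law X) A n : carried L A ->
  carried (iid L n) (fun xs => (size xs == n) && all A xs).
Proof.
move=> LA; elim: n => [|n IH] f g f0 fg /=; first exact: fg.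
apply: LA => [x|x Ax]; first exact: expect_ge0.
by apply: IH => // xs /andP[sx Axs]; apply: fg; rewrite /= eqSS sx Ax.
Qed.

Lemma eq_carried X (L : law X) A f g : carried L A ->
  (forall x, 0 <= f x) -> (forall x, 0 <= g x) -> (forall x, A x -> f x = g x) ->
  L f = L g.
Proof.
move=> LA f0 g0 fg; apply/eqP; rewrite eq_le.
by rewrite !LA// => x /fg ->.
Qed.

Definition pr X (L : law X) (A : set X) : \bar R := L (fun x => (\1_A x)%:E).

Lemma pr_ge0 X (L : law X) A : 0 <= pr L A.
Proof. exact: expect_ge0. Qed.

Lemma indic_le X Y (A : set X) (B : set Y) x y : (A x -> B y) ->
  (\1_A x)%:E <= (\1_B y)%:E :> \bar R.
Proof.
move=> AB; rewrite lee_fin /indic.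
have [/set_mem/AB/mem_set ->//|_] := boolP (x \in A).
by rewrite ler0n.
Qed.

Lemma pr_le_on X (L : law X) (C : pred X) A B : carried L C ->
  (forall x, C x -> A x -> B x) -> pr L A <= pr L B.
Proof. by move=> LC AB; apply: LC => // x Cx; apply: indic_le; exact: AB. Qed.

Lemma pr_le X (L : law X) A B : A `<=` B -> pr L A <= pr L B.
Proof. by move=> AB; apply: (pr_le_on (@carriedT _ L)) => x _; exact: AB. Qed.

Lemma pr_setU X (L : law X) A B : pr L (A `|` B) <= pr L A + pr L B.
Proof.
rewrite -expectD//; apply: expect_le => // x; rewrite -EFinD lee_fin /indic.
rewrite in_setU; case: (x \in A); case: (x \in B) => //=; lra.
Qed.

Lemma pr_set0 X (L : law X) : pr L set0 = 0.
Proof. by rewrite -(expect0 L); apply: eq_expect => x; rewrite indic0. Qed.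

Lemma pr_bigcup_ord X (L : law X) n (A : nat -> set X) :
  pr L [set x | exists2 i, (i < n)%N & A i x] <= \sum_(i < n) pr L (A i).
Proof.
elim: n => [|n IH].
  rewrite big_ord0 -(pr_set0 L); apply: pr_le => x /= [i]; lia.
rewrite big_ord_recr /=; apply: le_trans (leeD2r _ IH).
apply: le_trans (pr_setU _ _ _); apply: pr_le => x /= [i].
by rewrite ltnS leq_eqVlt => /predU1P[->|ilt]; [right|left; exists i].
Qed.

Lemma pr_setU_le X (L : law X) A B (x y : R) :
  pr L A <= x%:E -> pr L B <= y%:E -> pr L (A `|` B) <= (x + y)%R%:E.
Proof. by move=> Ax By; rewrite EFinD (le_trans (pr_setU _ _ _))// leeD. Qed.

Lemma pr_bigcup_le X (L : law X) n (A : nat -> set X) (x : R) :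
  (forall i, (i < n)%N -> pr L (A i) <= x%:E) ->
  pr L [set z | exists2 i, (i < n)%N & A i z] <= (n%:R * x)%R%:E.
Proof.
move=> Ax; apply: le_trans (pr_bigcup_ord _ _ _) _.
apply: (@le_trans _ _ (\sum_(i < n) x%:E)).
  by apply: lee_sum => i _; exact: Ax.
by rewrite sumEFin sumr_const card_ord lee_fin mulr_natl.
Qed.

End laws.

(** * The Burke property of Bernoulli-geometric queues *)

Section series_facts.
Context {R : realType}.
Local Open Scope ereal_scope.
Implicit Types f : nat -> \bar R.

Lemma nneseries_shift f : (forall k, 0 <= f k) ->
  \sum_(k <oo) f k = f 0%N + \sum_(k <oo) f k.+1.
Proof.
move=> f0; rewrite nneseries_recl//; congr (_ + _).
by rewrite -nneseries_addn//; apply: eq_eseriesr => k _; rewrite addn1.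
Qed.

Lemma nneseries_support f n : (forall k, 0 <= f k) ->
  (forall k, (n <= k)%N -> f k = 0) -> \sum_(k <oo) f k = \sum_(k < n) f k.
Proof.
move=> f0 fn; rewrite (nneseries_split 0 n)// add0n big_mkord.
by rewrite [X in _ + X]eseries0 ?adde0// => k /fn.
Qed.

Lemma nneseries_single f n : (forall k, 0 <= f k) ->
  (forall k, k != n -> f k = 0) -> \sum_(k <oo) f k = f n.
Proof.
move=> f0 fn; rewrite (@nneseriesD1 _ f n xpredT)//.
by rewrite eseries0 ?adde0// => k _ /= /fn.
Qed.

Lemma nneseries_geometric (a z : R) : (0 <= a)%R -> (0 <= z < 1)%R ->
  \sum_(k <oo) (a * z ^+ k)%:E = (a / (1 - z))%:E.
Proof.
move=> a0 /andP[z0 z1]; apply/cvg_lim => //; apply: cvg_EFin => //.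
  by apply: nearW => n; rewrite sumEFin.
rewrite [X in X @ _ --> _](_ : _ = series (geometric a z)).
  by apply: cvg_geometric_series; rewrite ger0_norm.
by apply/funext => n; rewrite /= sumEFin.
Qed.

End series_facts.

Section ber_geom_law.
Context {R : realType}.
Implicit Types (p a z : R) (k : nat).

Definition bg p a k : R := if k is k'.+1 then p * a * (1 - a) ^+ k' else 1 - p.

Lemma unit_itvW p : 0 < p < 1 -> 0 <= p <= 1.
Proof. by move=> /andP[? ?]; rewrite !ltW. Qed.

Lemma unit_itvWr p : 0 < p < 1 -> 0 < p <= 1.
Proof. by move=> /andP[-> /ltW]. Qed.

Lemma bg_ge0 p a : 0 <= p <= 1 -> 0 < a <= 1 -> forall k, 0 <= bg p a k.
Proof.
move=> /andP[p0 p1] /andP[a0 a1] [|k] /=; first by rewrite subr_ge0.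
by rewrite mulr_ge0 ?exprn_ge0 ?mulr_ge0 ?subr_ge0// ltW.
Qed.

Lemma bg_gen p a z : 0 <= p <= 1 -> 0 < a <= 1 -> 0 <= z -> (1 - a) * z < 1 ->
  (\sum_(k <oo) (bg p a k * z ^+ k)%:E =
   (1 - p + p * a * z / (1 - (1 - a) * z))%:E)%E.
Proof.
move=> pp aa z0 az; have [/andP[p0 p1] /andP[a0 a1]] := (pp, aa).
rewrite nneseries_shift; last first.
  by move=> k; rewrite lee_fin mulr_ge0 ?exprn_ge0 ?bg_ge0.
rewrite expr0 mulr1 [RHS]EFinD; congr (_ + _)%E.
rewrite -nneseries_geometric.
- by apply: eq_eseriesr => k _ /=; rewrite exprS exprMn; congr EFin; ring.
- by rewrite !mulr_ge0// ltW.
- by rewrite az mulr_ge0// subr_ge0.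
Qed.

Lemma bg_sum1 p a : 0 <= p <= 1 -> 0 < a <= 1 ->
  (\sum_(k <oo) (bg p a k)%:E = 1)%E.
Proof.
move=> pp aa; have /andP[a0 a1] := aa.
transitivity (\sum_(k <oo) (bg p a k * 1 ^+ k)%:E)%E.
  by apply: eq_eseriesr => k _; rewrite expr1n mulr1.
rewrite bg_gen// ?mulr1; last lra.
by congr EFin; field; lra.
Qed.

Definition BG p a (pp : 0 <= p <= 1) (aa : 0 < a <= 1) : law nat :=
  disc (bg_ge0 pp aa) (bg_sum1 pp aa).

End ber_geom_law.

(** * One site: arrival Ber(p)Geom(a), queue Ber(r)Geom(c), service Ber(q)Geom(b) *)

Section burke_site.
Context {R : realType}.
Variables (p q r a b c : R).
Hypotheses (pp : 0 <= p <= 1) (qq : 0 <= q <= 1) (rr : 0 <= r <= 1).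
Hypotheses (aa : 0 < a <= 1) (bb : 0 < b <= 1) (cc : 0 < c <= 1).
Hypotheses (q0 : q != 0) (ac : a * (1 - r) = c) (abc : 1 - a = (1 - b) * (1 - c)).
Hypotheses (hr : b * (1 - c) = a * r) (hrp : r * (q * (1 - p)) = p * (1 - q)).

Let U : law nat := BG pp aa.
Let V : law nat := BG rr cc.
Let S : law nat := BG qq bb.

(** The number v + u of customers present before service is Ber(p/q)Geom(c). *)
Lemma bg_convolution n : \sum_(i < n.+1) bg r c i * bg p a (n - i)%N =
  bg (p / q) c n.
Proof.
(* For i <= m the second factor has index at least 2, so lowering that index by one costs a factor 1
   - a; only the last two terms of the sum stay apart. *)
have conv2 m : \sum_(i < m.+3) bg r c i * bg p a (m.+2 - i)%N =
    (1 - a) * (\sum_(i < m.+2) bg r c i * bg p a (m.+1 - i)%N -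
               bg r c m.+1 * bg p a 0) + bg r c m.+1 * bg p a 1 +
    bg r c m.+2 * bg p a 0.
  rewrite big_ord_recr /= subnn big_ord_recr /= subSnn; congr (_ + _ + _).
  rewrite [in RHS]big_ord_recr /= subnn addrK mulr_sumr.
  apply: eq_bigr => i _; rewrite subSn; last by have := ltn_ord i; lia.
  rewrite (subSn (_ : (i <= m)%N))/=; last by have := ltn_ord i; lia.
  by rewrite exprS; ring.
have E0 : (1 - r) * (1 - p) = 1 - p / q.
  apply: (mulfI q0); transitivity (q - p); first by move: hrp; lra.
  by field.
case: n => [|n]; first by rewrite big_ord1.
elim: n => [|n IH].
  rewrite !big_ord_recr big_ord0 /= add0r !expr0 !mulr1 -ac.
  have -> : p / q = 1 - (1 - r) * (1 - p) by rewrite E0; ring.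
  by ring.
rewrite conv2 IH /= !exprS expr0 mulr1.
have -> : p / q = 1 - (1 - r) * (1 - p) by rewrite E0; ring.
rewrite -ac.
by ring.
Qed.

Let tail i : R := if i is i'.+1 then q * (1 - b) ^+ i' else 1.

Lemma bg_tail i :
  (\sum_(s <oo) (bg q b s * (i <= s)%:R)%:E = (tail i)%:E)%E.
Proof.
case: i => [|i].
  by rewrite -(bg_sum1 qq bb); apply: eq_eseriesr => k _; rewrite mulr1.
have /andP[b0 b1] := bb; have /andP[q_0 q_1] := qq.
rewrite (nneseries_split 0 i.+1); last first.
  by move=> k _; rewrite lee_fin mulr_ge0 ?bg_ge0 ?ler0n.
rewrite add0n big_nat_cond big1 ?add0e; last first.
  by move=> k; rewrite andbT /= => ki; rewrite leqNgt ki mulr0.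
rewrite -nneseries_addn; last first.
  by move=> k; rewrite lee_fin mulr_ge0 ?bg_ge0 ?ler0n.
transitivity (\sum_(k <oo) (q * b * (1 - b) ^+ i * (1 - b) ^+ k)%:E)%E.
  apply: eq_eseriesr => k _; rewrite addnS /= ltnS leq_addl mulr1 exprD.
  by congr EFin; ring.
rewrite nneseries_geometric; first by congr EFin => /=; field; lra.
  by rewrite mulr_ge0 ?exprn_ge0 ?mulr_ge0//; lra.
lra.
Qed.

(** Probability that i of i + j customers are served and j stay: emptying the queue only needs a
    service of at least i, whereas leftover customers force a service equal to i. *)
Let service i j : R := if j is 0 then tail i else bg q b i.

Lemma service_sum n i j :
  (\sum_(s <oo) (bg q b s)%:E * (\1_[set (i, j)] (minn n s, n - s)%N)%:E =
   (service i j * (n == i + j)%N%:R)%:E)%E.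
Proof.
have E s : \1_[set (i, j)] (minn n s, n - s)%N =
    ((minn n s == i) && (n - s == j)%N)%:R :> R.
  rewrite indicE; congr (_ %:R); congr nat_of_bool.
  by apply/idP/idP => [/set_mem [-> ->]|/andP[/eqP <- /eqP <-]];
    rewrite ?eqxx// inE.
under eq_eseriesr do rewrite E -EFinM.
case: j {E} => [|j] /=.
  transitivity (\sum_(s <oo) ((n == i)%:R * (bg q b s * (i <= s)%:R))%:E)%E.
    apply: eq_eseriesr => s _; congr EFin; rewrite mulrCA; congr (_ * _).
    by rewrite -natrM mulnb; congr (_%:R); lia.
  under eq_eseriesr do rewrite EFinM.
  rewrite nneseriesZl; last by move=> s _; rewrite lee_fin mulr_ge0 ?bg_ge0 ?ler0n.
  by rewrite bg_tail -EFinM mulrC addn0.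
rewrite (@nneseries_single _ _ i).
- by congr (_ * _)%:E; congr (_%:R); lia.
- by move=> k; rewrite lee_fin mulr_ge0 ?bg_ge0 ?ler0n.
- move=> k ki; rewrite [_ && _](_ : _ = false) ?mulr0//; lia.
Qed.

(** The joint mass of departures and remaining customers factorizes: they are independent and
    distributed like the arrival and the previous queue. *)
Lemma service_convolution i j :
  service i j * bg (p / q) c (i + j)%N = bg p a i * bg r c j.
Proof.
have /andP[a0 _] := aa.
have qK : q * (p / q) = p by field.
have hK : (p / q) * (1 - q) = r * (1 - p).
  by apply: (mulfI q0); rewrite mulrA qK -hrp; ring.
have E0 : 1 - p / q = (1 - r) * (1 - p).
  by apply: (mulfI q0); rewrite mulrBr qK; move: hrp; lra.
case: j i => [|j] [|i] /=.
- by rewrite mul1r E0 mulrC.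
- rewrite addn0 abc exprMn -ac -[in RHS]qK; ring.
- transitivity (((p / q) * (1 - q)) * (c * (1 - c) ^+ j)); first ring.
  by rewrite hK; ring.
- rewrite abc exprMn addnS exprS exprD.
  transitivity ((q * (p / q)) * (b * (1 - c)) *
    (c * (1 - b) ^+ i * (1 - c) ^+ i * (1 - c) ^+ j)); first ring.
  by rewrite qK hr; ring.
Qed.

(* The bound by 1 keeps the values of f finite, so that expectZ applies. *)
Lemma law_pair_ext (L M : law (nat * nat)) (f : nat * nat -> \bar R) :
  (forall z, 0 <= f z <= 1)%E -> (forall z, pr L [set z] = pr M [set z]) ->
  L f = M f.
Proof.
move=> f01 LM.
have f0 z : (0 <= f z)%E by have /andP[] := f01 z.
have ff z : f z = (fine (f z))%:E.
  rewrite fineK// ge0_fin_numE//; have /andP[_ f1] := f01 z.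
  by rewrite (le_lt_trans f1) ?ltry.
have fE : f = fun z => (\sum_(i <oo) \sum_(j <oo)
    (fine (f (i, j)))%:E * (\1_[set (i, j)] z)%:E)%E.
  apply/funext => -[m n]; apply/esym.
  have ge0 i j : (0 <= (fine (f (i, j)))%:E * (\1_[set (i, j)] (m, n))%:E)%E.
    by rewrite mule_ge0 -?ff ?lee_fin.
  have eq0 i j : (m, n) != (i, j) ->
      ((fine (f (i, j)))%:E * (\1_[set (i, j)] (m, n))%:E = 0)%E.
    move=> mnij; rewrite indicE memNset ?mule0//= => mij.
    by rewrite mij eqxx in mnij.
  rewrite (@nneseries_single _ _ m).
  - rewrite (@nneseries_single _ _ n) => [||k kn]; last first.
    + by apply: eq0; rewrite xpair_eqE eqxx eq_sym.
    + exact: ge0.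
    + by rewrite -ff indicE mem_set ?mule1.
  - by move=> k; apply: nneseries_ge0 => *; exact: ge0.
  - move=> k km; rewrite eseries0// => j _ _; apply: eq0.
    by rewrite xpair_eqE negb_and eq_sym km.
have push (N : law (nat * nat)) : N f = (\sum_(i <oo) \sum_(j <oo)
    (fine (f (i, j)))%:E * pr N [set (i, j)])%E.
  rewrite [in LHS]fE expect_series; last first.
    by move=> i z; apply: nneseries_ge0 => j _ _; rewrite mule_ge0 -?ff ?lee_fin.
  apply: eq_eseriesr => i _; rewrite expect_series; last first.
    by move=> j z; rewrite mule_ge0 -?ff ?lee_fin.
  apply: eq_eseriesr => j _; rewrite expectZ//.
  by rewrite -lee_fin -ff.
by rewrite !push; apply: eq_eseriesr => i _; apply: eq_eseriesr => j _; rewrite LM.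
Qed.

(** By [law_pair_ext] only point masses have to be compared. Given n customers present, the outcome
    (i, j) requires n = i + j, so its mass is [service i j] times a convolution of the laws of v and
    u, which [service_convolution] factorizes. *)
Lemma burke_site (f : nat -> nat -> \bar R) : (forall i j, 0 <= f i j <= 1)%E ->
  V (fun v => U (fun u => S (fun s => f (minn (v + u) s) (v + u - s)%N))) =
  U (fun u => V (fun v => f u v)).
Proof.
move=> f01.
apply: (@law_pair_ext
  (bind V (fun v => bind U (fun u => bind S (fun s =>
     ret (minn (v + u) s, (v + u - s)%N)))))
  (bind U (fun u => bind V (fun v => ret (u, v))))
  (fun z => f z.1 z.2)) => [z|[i j]]; first exact: f01.
have U0 := bg_ge0 pp aa; have V0 := bg_ge0 rr cc; have S0 := bg_ge0 qq bb.
have tail0 : 0 <= tail i.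
  have /andP[b0 b1] := bb; have /andP[q_0 q_1] := qq.
  by case: (i) => //= k; rewrite mulr_ge0 ?exprn_ge0//; lra.
have ser0 : 0 <= service i j by case: (j) => /=.
rewrite /pr /=.
transitivity (service i j * bg (p / q) c (i + j)%N)%:E; last first.
  rewrite (@nneseries_single _ _ i).
  - rewrite (@nneseries_single _ _ j).
    + rewrite indicE mem_set//= mule1 -EFinM; congr EFin.
      exact: service_convolution.
    + by move=> k; rewrite mule_ge0 ?lee_fin.
    + move=> k kj; rewrite indicE memNset ?mule0//= => -[kj'].
      by rewrite kj' eqxx in kj.
  - move=> k; rewrite mule_ge0 ?lee_fin//; apply: nneseries_ge0 => *.
    by rewrite mule_ge0 ?lee_fin.
  - move=> k ki; rewrite eseries0 ?mule0// => l _ _.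
    rewrite indicE memNset ?mule0//= => -[ki' _].
    by rewrite ki' eqxx in ki.
transitivity (\sum_(v <oo) (service i j *
    (bg r c v * (if (v <= i + j)%N then bg p a (i + j - v)%N else 0)))%:E)%E.
  apply: eq_eseriesr => v _.
  under eq_eseriesr do rewrite service_sum.
  rewrite -(mulrCA (bg r c v)) EFinM; congr (_ * _)%E.
  case: leqP => [vn|nv]; last first.
    rewrite mulr0 eseries0// => u _ _.
    by rewrite [_ == _](_ : _ = false) ?mulr0 ?mule0//; lia.
  rewrite (@nneseries_single _ _ (i + j - v)%N).
  - by rewrite subnKC// eqxx mulr1 -EFinM mulrC.
  - by move=> k; rewrite mule_ge0 ?lee_fin// mulr_ge0 ?ler0n.
  - move=> k kn; rewrite [_ == _](_ : _ = false) ?mulr0 ?mule0//; lia.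
rewrite (@nneseries_support _ _ (i + j)%N.+1).
- rewrite sumEFin -mulr_sumr -bg_convolution; congr (_ * _)%:E.
  by apply: eq_bigr => v _; rewrite -ltnS ltn_ord.
- move=> k; rewrite lee_fin mulr_ge0// mulr_ge0//; case: ifP => //.
- by move=> k kn; rewrite leqNgt kn !mulr0.
Qed.

End burke_site.

(** * From one site to a row, and from a row to a stack of rows *)

Section burke_rows.
Context {R : realType}.
Local Open Scope ereal_scope.
Variables U V S : law (R := R) nat.
Hypotheses (swapsV : swaps V) (swapsS : swaps S).
Hypothesis burke : forall f : nat -> nat -> \bar R, (forall i j, 0 <= f i j <= 1) ->
  V (fun v => U (fun u => S (fun s => f (minn (v + u) s) (v + u - s)%N))) =
  U (fun u => V (fun v => f u v)).

Lemma expect_01 X (L : law (R := R) X) f : (forall x, 0 <= f x <= 1) ->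
  0 <= L f <= 1.
Proof.
move=> f01; have f0 x : 0 <= f x by have /andP[] := f01 x.
rewrite expect_ge0//= -(expect1 L); apply: expect_le => // x.
by have /andP[] := f01 x.
Qed.

(** Induction on the columns: the queue handed to the next column has law [V] again and is
    independent of the departure just recorded. *)
Lemma burke_row n f : (forall x, 0 <= f x <= 1) ->
  V (fun v => iid U n (fun us => iid S n (fun ss => f (queue v us ss)))) =
  iid U n (fun us => V (fun v => f (us, v))).
Proof.
elim: n f => [//|n IH] f f01 /=.
have f0 x : 0 <= f x by have /andP[] := f01 x.
pose g i j := iid U n (fun us => iid S n (fun ss =>
  f (i :: (queue j us ss).1, (queue j us ss).2))).
transitivity (V (fun v => U (fun u => S (fun s =>
    g (minn (v + u) s) (v + u - s)%N)))).
  apply: eq_expect => v; apply: eq_expect => u; apply/esym.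
  apply: swapsS => s us; exact: expect_ge0.
rewrite (burke (f := g)); last first.
  by move=> i j; do 2 apply: expect_01 => ?; exact: f01.
by apply: eq_expect => u; rewrite (IH (fun z => f (u :: z.1, z.2))).
Qed.

(** The departures of a row are again i.i.d. with law [U], and the next row draws fresh queue
    lengths and services, so the final queue of each row may be integrated out. *)
Lemma burke_tandem M n f : (forall x, 0 <= f x <= 1) ->
  iid U n (fun us => iid (prodl V (iid S n)) M (fun xs => f (tandem us xs))) =
  iid U n f.
Proof.
move=> f01; have f0 x : 0 <= f x by have /andP[] := f01 x.
elim: M => [|M IH]; first exact: eq_expect.
pose h us := iid (prodl V (iid S n)) M (fun xs => f (tandem us xs)).
have h01 us : 0 <= h us <= 1 by apply: expect_01 => xs; exact: f01.
rewrite -IH /=.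
transitivity (V (fun v => iid U n (fun us => iid S n (fun ss =>
    h (queue v us ss).1)))).
  apply/esym; apply: swapsV => v us; apply: expect_ge0 => ss.
  by have /andP[] := h01 (queue v us ss).1.
rewrite (burke_row n (f := fun z => h z.1))//.
by apply: eq_expect => us; apply: (@expect_cst _ _ V (h us)); have /andP[] := h01 us.
Qed.

End burke_rows.

(** * Chernoff bounds for sums of Bernoulli-geometric variables *)

Section chernoff.
Context {R : realType}.

Lemma iid_mgf (L : law (R := R) nat) (t s : R) n :
  (L (fun k => (expR (t * k%:R - s))%:E) <= 1)%E ->
  (iid L n (fun xs => (expR (t * (sumn xs)%:R - s * n%:R))%:E) <= 1)%E.
Proof.
move=> L1; elim: n => [|n IH] /=; first by rewrite !mulr0 subrr expR0.
apply: le_trans L1; apply: expect_le => [k|k].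
  by apply: expect_ge0 => xs; rewrite lee_fin expR_ge0.
rewrite -[leRHS]mule1; apply: le_trans (lee_wpmul2l _ IH); last first.
  by rewrite lee_fin expR_ge0.
rewrite -expectZ ?expR_ge0//.
apply: expect_le => xs; rewrite ?lee_fin ?expR_ge0//.
by rewrite -expRD natrD -natr1 le_eqVlt; apply/orP; left; apply/eqP; congr expR; ring.
Qed.

Lemma iid_chernoff (L : law (R := R) nat) (t s y : R) n :
  (L (fun k => (expR (t * k%:R - s))%:E) <= 1)%E ->
  (pr (iid L n) [set xs | y <= t * (sumn xs)%:R - s * n%:R]%R <=
   (expR (- y))%:E)%E.
Proof.
move=> /(@iid_mgf _ _ _ n) L1.
rewrite -[leRHS]mule1; apply: le_trans (lee_wpmul2l _ L1); last first.
  by rewrite lee_fin expR_ge0.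
rewrite -expectZ ?expR_ge0//.
apply: expect_le => xs; rewrite lee_fin// -expRD indicE.
have [/set_mem /= yx|_] := boolP (xs \in _); last by rewrite expR_ge0.
by rewrite -[leLHS]expR0 ler_expR addrC subr_ge0.
Qed.

Variables p a : R.
Hypotheses (pp : 0 <= p <= 1) (aa : 0 < a <= 1) (p0 : 0 < p).

Lemma BG_mgf (z s : R) : 0 < z -> (1 - a) * z < 1 ->
  1 - p + p * a * z / (1 - (1 - a) * z) <= expR s ->
  (BG pp aa (fun k => (expR (ln z * k%:R - s))%:E) <= 1)%E.
Proof.
move=> z0 az le.
rewrite [leLHS](_ : _ =
    (expR (- s))%:E * \sum_(k <oo) (bg p a k * z ^+ k)%:E)%E; last first.
  rewrite -nneseriesZl; last first.
    by move=> k _; rewrite lee_fin mulr_ge0 ?bg_ge0// exprn_ge0// ltW.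
  apply: eq_eseriesr => k _; rewrite -!EFinM expRD expRM_natr lnK ?posrE//.
  by congr EFin; ring.
rewrite bg_gen ?(ltW z0)// -EFinM lee_fin expRN mulrC.
by rewrite ler_pdivrMr ?expR_gt0// mul1r.
Qed.

Lemma BG_upper_tail e : 0 < e -> exists2 t, 0 < t & forall n y,
  (pr (iid (BG pp aa) n) [set xs | n%:R * (p / a + e) + y <= (sumn xs)%:R]%R <=
   (expR (- (t * y)))%:E)%E.
Proof.
move=> e0; have /andP[a0 a1] := aa.
pose m := p / a + e.
have pa0 : 0 < p / a by rewrite divr_gt0.
have m0 : 0 < m by rewrite /m; lra.
have pam : p = p / a * a by rewrite mulfVK//; lra.
(* For z = 1 + h, the estimates ln (1 + h) >= h / (1 + h) and exp y >= 1 + y reduce the moment bound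
   to p (1 + h) <= m (a - (1 - a) h); this [h] gives equality. *)
pose h := e * a / (p + m * (1 - a)).
have d0 : 0 < p + m * (1 - a).
  by rewrite ltr_pwDl// mulr_ge0 ?subr_ge0// ltW.
have h0 : 0 < h by rewrite !divr_gt0// mulr_gt0.
have hE : h * p + h * (m * (1 - a)) = e * a by rewrite /h; field; lra.
have ha : (1 - a) * h < a.
  rewrite -(ltr_pM2l m0); have := mulr_gt0 h0 p0.
  have := mulr_gt0 a0 pa0; rewrite /m in hE *; lra.
exists (ln (1 + h)) => [|n y]; first by rewrite ln_gt0//; lra.
have lnh : h / (1 + h) <= ln (1 + h).
  have := @le_ln1Dx _ (- (h / (1 + h))).
  have -> : 1 - h / (1 + h) = (1 + h)^-1 by field; lra.
  rewrite lnV ?posrE; last lra.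
  rewrite lerN2 => -> //; rewrite ltrN2 ltr_pdivrMr; lra.
have d1 : 0 < 1 - (1 - a) * (1 + h) by lra.
suff mgf : 1 - p + p * a * (1 + h) / (1 - (1 - a) * (1 + h)) <= expR (ln (1 + h) * m).
  have z0 : 0 < 1 + h by lra.
  have az : (1 - a) * (1 + h) < 1 by lra.
  apply: le_trans (iid_chernoff (ln (1 + h) * y) n (BG_mgf z0 az mgf)).
  have l0 : 0 <= ln (1 + h) by rewrite ln_ge0//; lra.
  by apply: pr_le => xs /= /(ler_wpM2l l0); rewrite /m; lra.
apply: le_trans (expR_ge1Dx _).
rewrite -addrA lerD2l; apply: le_trans (_ : p * h / (1 - (1 - a) * (1 + h)) <= _).
  by rewrite le_eqVlt; apply/orP; left; apply/eqP; field; lra.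
apply: le_trans (ler_wpM2r (ltW m0) lnh).
rewrite ler_pdivrMr//.
rewrite (_ : h / _ * m * _ = h * (m * (1 - (1 - a) * (1 + h))) / (1 + h)); last ring.
rewrite ler_pdivlMr; last lra.
have : h * (p * (1 + h)) <= h * (m * (1 - (1 - a) * (1 + h))); last lra.
rewrite ler_pM2l//; rewrite /m in hE *; lra.
Qed.

Lemma BG_lower_tail e : 0 < e -> exists2 t, 0 < t & forall n y,
  (pr (iid (BG pp aa) n) [set xs | (sumn xs)%:R <= n%:R * (p / a - e) - y]%R <=
   (expR (- (t * y)))%:E)%E.
Proof.
move=> e0; have /andP[a0 a1] := aa.
pose m := p / a - e.
have pa0 : 0 < p / a by rewrite divr_gt0.
have pam : p = p / a * a by rewrite mulfVK//; lra.
(* For z = 1 - h the inequality needed is h (p + m (1 - a)) <= e a, and its left side is at most h p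
   / a because m <= p / a. The bound 1/2 keeps 1 - h positive. *)
pose h := Num.min 2^-1 (e * a / (p / a)).
have h0 : 0 < h by rewrite /h lt_min invr_gt0 ltr0n /= divr_gt0// mulr_gt0.
have h1 : h <= 2^-1 by rewrite /h ge_min lexx.
have hE : h * (p / a) <= e * a.
  by rewrite -ler_pdivlMr// /h ge_min lexx orbT.
exists (- ln (1 - h)) => [|n y]; first by rewrite oppr_gt0 ln_lt0//; lra.
have lnh : - ln (1 - h) <= h / (1 - h).
  rewrite -lnV ?posrE; last lra.
  rewrite [X in ln X](_ : _ = 1 + h / (1 - h)); last by field; lra.
  have h2 : 0 < h / (1 - h) by rewrite divr_gt0//; lra.
  by apply: le_ln1Dx; lra.
have l0 : 0 < - ln (1 - h) by rewrite oppr_gt0 ln_lt0//; lra.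
have d1 : 0 < 1 - (1 - a) * (1 - h).
  have : 0 <= (1 - a) * h by rewrite mulr_ge0; lra.
  lra.
suff mgf : 1 - p + p * a * (1 - h) / (1 - (1 - a) * (1 - h)) <= expR (ln (1 - h) * m).
  have z0 : 0 < 1 - h by lra.
  have az : (1 - a) * (1 - h) < 1 by lra.
  apply: le_trans (iid_chernoff (- ln (1 - h) * y) n (BG_mgf z0 az mgf)).
  by apply: pr_le => xs /= /(ler_wpM2l (ltW l0)); rewrite /m; lra.
apply: le_trans (expR_ge1Dx _).
rewrite -addrA lerD2l; apply: le_trans (_ : - (p * h / (1 - (1 - a) * (1 - h))) <= _).
  by rewrite le_eqVlt; apply/orP; left; apply/eqP; field; lra.
rewrite -[ln _]opprK mulNr lerN2.
have [m0|m0] := leP m 0.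
  apply: (@le_trans _ _ 0); first by rewrite mulr_ge0_le0// ltW.
  by rewrite divr_ge0 ?mulr_ge0// ltW.
apply: (le_trans (ler_wpM2r (ltW m0) lnh)).
rewrite ler_pdivlMr//.
rewrite (_ : h / _ * m * _ = h * (m * (1 - (1 - a) * (1 - h))) / (1 - h)); last ring.
rewrite ler_pdivrMr; last lra.
have : h * (m * (1 - (1 - a) * (1 - h))) <= h * (p * (1 - h)); last lra.
rewrite ler_pM2l//.
have : e * (1 - a) * h >= 0 by rewrite !mulr_ge0//; lra.
have : h * p = h * (p / a) * a by rewrite {1}pam mulrA.
rewrite /m; lra.
Qed.

End chernoff.

(** * Stationary parameters *)

Section params.
Context {R : realType}.
Variables q b : R.
Hypotheses (q01 : 0 < q < 1) (b01 : 0 < b < 1).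
Implicit Types a : R.

(* The stationary arrivals are Ber(p)Geom(a) with p = q b (1 - a) / den a, the
   queue lengths Ber(r)Geom(c) with r = b (1 - a) / (a (1 - b)) and
   c = (a - b) / (1 - b); the means below are p / a and r / c. *)
Definition den a := a * (1 - b - q) + b * q.
Definition mean_arrival a := q * b * (1 - a) / (den a * a).
Definition mean_queue a := b * (1 - a) / (a * (a - b)).

Lemma denE a : den a = (1 - a) * b + (a - b) * (1 - q).
Proof. by rewrite /den; ring. Qed.

Lemma den_gt0 a : b < a < 1 -> 0 < den a.
Proof.
move=> /andP[ba a1]; have /andP[q0 q1] := q01; have /andP[b0 b1] := b01.
by rewrite denE addr_gt0 ?mulr_gt0 ?subr_gt0.
Qed.

Lemma mean_arrival_ge0 a : b < a < 1 -> 0 <= mean_arrival a.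
Proof.
move=> ha; have /andP[ba a1] := ha; have D0 := den_gt0 ha.
have /andP[q0 q1] := q01; have /andP[b0 b1] := b01; have a0 := lt_trans b0 ba.
by rewrite /mean_arrival divr_ge0 ?mulr_ge0 ?subr_ge0// ltW.
Qed.

Lemma mean_queue_ge0 a : b < a < 1 -> 0 <= mean_queue a.
Proof.
move=> /andP[ba a1]; have /andP[b0 b1] := b01; have a0 := lt_trans b0 ba.
by rewrite /mean_queue divr_ge0 ?mulr_ge0 ?subr_ge0// ltW.
Qed.

(** The additive [y] makes the estimate uniform in [n]: short partial sums get the same exponential
    bound as long ones. *)
Definition tails (L : law (R := R) nat) (m : R) := forall e, 0 < e ->
  exists2 t, 0 < t & forall n y, 0 <= y ->
  (pr (iid L n) [set xs | n%:R * (m + e) + y <= (sumn xs)%:R]%R <=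
     (expR (- (t * y)))%:E)%E /\
  (pr (iid L n) [set xs | (sumn xs)%:R <= n%:R * (m - e) - y]%R <=
     (expR (- (t * y)))%:E)%E.

Lemma BG_tails p a (pp : 0 <= p <= 1) (aa : 0 < a <= 1) : 0 < p ->
  tails (BG pp aa) (p / a).
Proof.
move=> p0 e e0.
have [t t0 ht] := BG_upper_tail pp aa p0 e0.
have [s s0 hs] := BG_lower_tail pp aa p0 e0.
exists (Num.min s t) => [|n y y0]; first by rewrite lt_min s0.
split; [apply: le_trans (ht n y) _|apply: le_trans (hs n y) _];
  by rewrite lee_fin ler_expR lerN2 ler_wpM2r// ge_min lexx ?orbT.
Qed.

Definition service_law := BG (unit_itvW q01) (unit_itvWr b01).

(** The parameters p, r, c computed from [a] satisfy the algebraic relations required by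
    [burke_site]. *)
Lemma stationary_laws a : b < a < 1 -> exists U V : law (R := R) nat,
  [/\ tails U (mean_arrival a), tails V (mean_queue a) &
    forall M n f, (forall x, (0 <= f x <= 1)%E) ->
      iid U n (fun us => iid (prodl V (iid service_law n)) M
        (fun xs => f (tandem us xs))) = iid U n f].
Proof.
move=> ba1; have D0 := den_gt0 ba1; have DE := denE a.
have /andP[ba a1] := ba1.
have /andP[q0 q1] := q01; have /andP[b0 b1] := b01; have a0 := lt_trans b0 ba.
pose p := q * b * (1 - a) / den a.
pose r := b * (1 - a) / (a * (1 - b)).
pose c := (a - b) / (1 - b).
have p0 : 0 < p by rewrite /p divr_gt0// !mulr_gt0// subr_gt0.
have r0 : 0 < r by rewrite /r divr_gt0// !mulr_gt0// subr_gt0.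
have c0 : 0 < c by rewrite /c divr_gt0// !subr_gt0.
have p1 : 1 - p = a * (1 - b) * (1 - q) / den a.
  by rewrite /p /den in D0 *; field; lra.
have r1 : 1 - r = (a - b) / (a * (1 - b)) by rewrite /r; field; lra.
have c1 : 1 - c = (1 - a) / (1 - b) by rewrite /c; field; lra.
have pp : 0 <= p <= 1.
  by rewrite (ltW p0) -subr_ge0 p1 divr_ge0 ?mulr_ge0// ?ltW// subr_gt0.
have rr : 0 <= r <= 1.
  by rewrite (ltW r0) -subr_ge0 r1 divr_ge0 ?mulr_ge0// ?ltW// subr_gt0.
have cc : 0 < c <= 1.
  by rewrite c0 -subr_ge0 c1 divr_ge0// ltW// subr_gt0.
have aa : 0 < a <= 1 by rewrite a0 ltW.
exists (BG pp aa), (BG rr cc); split.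
- have -> : mean_arrival a = p / a by rewrite /mean_arrival /p; field; lra.
  exact: BG_tails.
- have -> : mean_queue a = r / c by rewrite /mean_queue /r /c; field; lra.
  exact: BG_tails.
apply: burke_tandem; try exact: swaps_disc.
apply: burke_site.
- lra.
- by rewrite r1 /c; field; lra.
- by rewrite c1; field; lra.
- by rewrite c1 /r; field; lra.
- by rewrite p1 /r /p; field; lra.
Qed.

End params.

(** * Exponential bounds for passage times *)

Section percolation_bounds.
Context {R : realType}.
Variables q b : R.
Hypotheses (q01 : 0 < q < 1) (b01 : 0 < b < 1).
Let S : law (R := R) nat := service_law q01 b01.

Definition env_law M n : law (R := R) (seq (seq nat)) := iid (iid S n) M.

Section joint.
Variables (U V : law (R := R) nat) (M n : nat).
Hypothesis burke : forall M n f, (forall x, (0 <= f x <= 1)%E) ->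
  iid U n (fun us => iid (prodl V (iid S n)) M (fun xs => f (tandem us xs))) =
  iid U n f.

Definition joint : law (R := R) (seq nat * seq (nat * seq nat)) :=
  prodl (iid U n) (iid (prodl V (iid S n)) M).

Lemma indic01 X (A : set X) x : (0 <= (\1_A x : R)%:E <= 1)%E.
Proof. by rewrite !lee_fin indicE ler0n lern1 leq_b1. Qed.

Lemma pr_joint_top A :
  pr joint [set z | A (tandem z.1 z.2)] = pr (iid U n) A.
Proof.
by apply: (burke M n (f := fun us => (\1_A us)%:E)) => us; exact: indic01.
Qed.

Lemma pr_joint_arrivals A : pr joint [set z | A z.1] = pr (iid U n) A.
Proof.
rewrite /pr /joint /=; apply: eq_expect => us.
by apply: (@expect_cst _ _ _ (\1_A us)%:E).
Qed.

Lemma pr_joint_queues A :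
  pr joint [set z | A (unzip1 z.2)] = pr (iid V M) A.
Proof.
rewrite /pr /joint /=; transitivity (iid U n (fun=> pr (iid V M) A)).
  apply: eq_expect => us; rewrite /pr.
  rewrite -(@iid_map _ _ _ (prodl V (iid S n)) V fst)// => f f0 /=.
  by apply: eq_expect => v; rewrite expect_cst.
by rewrite expect_cst// pr_ge0.
Qed.

Lemma pr_joint_env A :
  pr joint [set z | A (unzip2 z.2)] = pr (env_law M n) A.
Proof.
rewrite /pr /joint /=; transitivity (iid U n (fun=> pr (env_law M n) A)).
  apply: eq_expect => us; rewrite /pr.
  rewrite -(@iid_map _ _ _ (prodl V (iid S n)) (iid S n) snd)// => f f0 /=.
  by rewrite expect_cst// expect_ge0.
by rewrite expect_cst// pr_ge0.
Qed.

Lemma carried_joint : carried joint (fun z =>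
  [&& size z.1 == n, size z.2 == M & all (fun x => size x.2 == n) z.2]).
Proof.
move=> f g f0 fg.
apply: (carried_prodl (carried_iid (carriedT U))
  (carried_iid (carried_prodl (carriedT V) (carried_iid (carriedT S))))) => //.
move=> [us xs] /= /andP[/andP[szu _] /andP[szx ax]]; apply: fg.
rewrite /= szu szx/=; apply: sub_all ax => -[v ss] /=.
by move=> /andP[].
Qed.

End joint.

Lemma pr_env_drop M n i A : (i <= n)%N ->
  pr (env_law M n) [set rows | A (map (drop i) rows)] = pr (env_law M (n - i)) A.
Proof.
move=> ni; rewrite /pr /env_law -(@iid_map _ _ _ (iid S n) (iid S (n - i)) (drop i))//.
by move=> f f0; rewrite iid_drop.
Qed.

Lemma pr_env_drop_rows M n m A : (m <= M)%N ->
  pr (env_law M n) [set rows | A (drop m rows)] = pr (env_law (M - m) n) A.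
Proof. by move=> mM; rewrite /pr /env_law -iid_drop. Qed.

Lemma pr_env_first M n A :
  pr (env_law M.+1 n) [set rows | A (head [::] rows)] = pr (iid S n) A.
Proof.
rewrite /pr /env_law /=; apply: eq_expect => ss.
by apply: (@expect_cst _ _ _ (\1_A ss)%:E).
Qed.

(** By [tandem_le_reach] with i = 0, a cheap path from the corner forces either few departures from
    the top row, whose law is that of the arrivals by stationarity, or a large sum of queue
    lengths. *)
Lemma reach_lower_tail a e : b < a < 1 -> 0 < e ->
  exists2 t, 0 < t & forall n M y, 0 <= y ->
  (pr (env_law M n) [set rows | exists c, reach rows n 0 c /\
     c%:R <= n%:R * (mean_arrival q b a - e) - M%:R * (mean_queue b a + e)
       - y *+ 2]%R <= (expR (- (t * y)) *+ 2)%:E)%E.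
Proof.
move=> a1 e0; have [U [V [tU tV burke]]] := stationary_laws q01 b01 a1.
have [t t0 ht] := tU e e0; have [s s0 hs] := tV e e0.
exists (Num.min s t) => [|n M y y0]; first by rewrite lt_min s0.
have [_ h1] := ht n y y0; have [h2 _] := hs M y y0.
rewrite -(pr_joint_env U V).
apply: (@le_trans _ _ (expR (- (t * y)) + expR (- (s * y)))%:E); last first.
  rewrite lee_fin mulr2n lerD// ler_expR lerN2 ler_wpM2r// ge_min lexx ?orbT//.
rewrite EFinD; apply: le_trans (leeD h1 h2).
rewrite -(@pr_joint_top U V M n burke) -(pr_joint_queues U V M n).
apply: le_trans (pr_setU _ _ _).
apply: (pr_le_on (@carried_joint U V M n)) => -[us xs].
move=> /and3P[/= /eqP szu /eqP szx ax] [c [rc hc]].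
have := tandem_le_reach szu ax rc; rewrite take0 add0n -(ler_nat R) natrD => le.
have [h|h] := leP (M%:R * (mean_queue b a + e) + y) (sumn (unzip1 xs))%:R.
  by right.
left => /=; rewrite /= in hc *; lra.
Qed.

Variables (x : R) (a : R).
Hypotheses (x0 : 0 < x) (ha : b < a < 1).
Let A := mean_arrival q b a.
Let B := mean_queue b a.
(** First-order optimality of [a]: the arrival mean can be lowered while the objective loses only a
    fraction [dl] of the decrease. This makes late exits from the bottom expensive; [larger_queue]
    does the same for the left side. *)
Hypothesis smaller_arrival : forall dl, 0 < dl -> exists a1,
  [/\ b < a1 < 1, mean_arrival q b a1 < A &
  x * A - B - (x * mean_arrival q b a1 - mean_queue b a1) <=
    dl * (A - mean_arrival q b a1)].
Hypothesis larger_queue : forall dl, 0 < dl -> exists a2,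
  [/\ b < a2 < 1, B < mean_queue b a2 &
  x * A - B - (x * mean_arrival q b a2 - mean_queue b a2) <=
    dl * (mean_queue b a2 - B)].

(** Outside a few atypical events, [tandem_ge_reach] supplies an exit point. A far exit contradicts
    the lower bounds with the changed parameters; a near exit completes to a path from the corner
    that is too cheap for the event considered. *)
Lemma reach_upper_tail ep : 0 < ep -> exists C t N0, 0 < t /\
  forall N n, (N0 <= N)%N -> x * N%:R <= n%:R <= x * N%:R + 1 ->
  (pr (env_law N.+1 n) [set rows | forall c, reach rows n 0 c ->
      N%:R * (x * A - B + ep) <= c%:R]%R <=
   (C * N.+1%:R * expR (- (t * N%:R)))%:E)%E.
Proof.
move=> ep0.
have x_gt0 := x0; have [q0 _] := andP q01; have [b0 _] := andP b01.
have A0 : 0 <= A := mean_arrival_ge0 q01 b01 ha.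
have B0 : 0 <= B := mean_queue_ge0 b01 ha.
pose s := q / b.
have s0 : 0 < s by rewrite divr_gt0.
(* Exits within [dl N] of the corner count as near. Returning from one costs about dl (s + e) N
   along the bottom or dl (B + e) N along the left, and either is at most ep N / 4 since e <= 1. *)
pose dl := ep / 4 / (s + B + 2).
have sB : 0 < s + B + 2 by lra.
have dl0 : 0 < dl by rewrite !divr_gt0.
have dlE : dl * (s + B + 2) = ep / 4 by rewrite mulfVK// gt_eqF.
(* Half of the far-exit penalty compensates the loss in the objective; the other half remains to
   absorb the errors. *)
have dl2 : 0 < dl / 2 by lra.
have [c1 [hc1]] := smaller_arrival dl2.
have [c2 [hc2]] := larger_queue dl2.
have := mean_arrival_ge0 q01 b01 hc1; have := mean_queue_ge0 b01 hc1.
have := mean_arrival_ge0 q01 b01 hc2; have := mean_queue_ge0 b01 hc2.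
set A1 := mean_arrival q b c1; set B1 := mean_queue b c1.
set A2 := mean_arrival q b c2; set B2 := mean_queue b c2.
move=> B20 A20 B10 A10 G2 crit2 G1 crit1.
(* [k] is the error allowed per unit of [N], small against [ep] and both far-exit penalties. The
   slack [e] keeps the deviations below [k N], and [N0] does so for the bounded terms. *)
pose k := Num.min (ep / 8) (Num.min (dl * (A - A1) / 8) (dl * (B2 - B) / 8)).
have k0 : 0 < k.
  by rewrite !lt_min !divr_gt0// mulr_gt0// subr_gt0.
have k1 : k <= ep / 8 by rewrite ge_min lexx.
have k2 : k <= dl * (A - A1) / 8 by rewrite !ge_min lexx !orbT.
have k3 : k <= dl * (B2 - B) / 8 by rewrite !ge_min lexx !orbT.
pose e := Num.min 1 (k / (2 * x + 10)).
have xp : 0 < 2 * x + 10 by lra.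
have e0 : 0 < e by rewrite lt_min ltr01 divr_gt0.
have e1 : e <= 1 by rewrite ge_min lexx.
have ek : e * (2 * x + 10) <= k by rewrite -ler_pdivlMr// ge_min lexx orbT.
pose K := A + B + A1 + B1 + A2 + B2 + s + 20.
pose N0 := (Num.truncn (K / k)).+1.
have KN N : (N0 <= N)%N -> K <= k * N%:R.
  move=> N0N; rewrite mulrC -ler_pdivrMr//.
  apply: (le_trans (ltW (truncnS_gt _))).
  by rewrite ler_nat.
have [U [V [tU tV burke]]] := stationary_laws q01 b01 ha.
have tS : tails S s by apply: BG_tails.
have [t1 t10 h1] := tU e e0; have [t2 t20 h2] := tV e e0.
have [t3 t30 h3] := tS e e0.
have [t4 t40 h4] := reach_lower_tail hc1 e0.
have [t5 t50 h5] := reach_lower_tail hc2 e0.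
pose t := Num.min (Num.min t1 t2) (Num.min t3 (Num.min t4 t5)).
have t0 : 0 < t by rewrite !lt_min t10 t20 t30 t40 t50.
(* The union bound below has 2 + 4 (n + 1) + 3 (N + 1) terms, where n <= x N + 1. *)
exists (4 * x + 20), (t * e), N0; split; first exact: mulr_gt0.
move=> N n N0N /andP[nx nx1]; have {N0N} KN := KN _ N0N.
have N_ge0 : 0 <= N%:R :> R by [].
pose y := e * N%:R; have y0 : 0 <= y by rewrite mulr_ge0// ltW.
pose w := expR (- (t * y)).
have w0 : 0 <= w by rewrite expR_ge0.
have expw t' : t <= t' -> expR (- (t' * y)) <= w.
  by move=> tt'; rewrite ler_expR lerN2 ler_wpM2r.
have [w1 w2] : expR (- (t1 * y)) <= w /\ expR (- (t2 * y)) <= w.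
  by split; apply: expw; rewrite !ge_min lexx ?orbT.
have w3 : expR (- (t3 * y)) <= w by apply: expw; rewrite !ge_min lexx ?orbT.
have [w4 w5] : expR (- (t4 * y)) <= w /\ expR (- (t5 * y)) <= w.
  by split; apply: expw; rewrite !ge_min lexx ?orbT.
pose M := N.+1.
pose L := joint U V M n.
(* E1, E2: the boundary process is atypical; E3, E4 and E5, E6: an exit from the
   bottom, resp. from the left, is cheaper than the bound with parameter c1,
   resp. c2, allows; E7: the bottom row is expensive. *)
pose E1 := [set z : seq nat * seq (nat * seq nat) |
  n%:R * (A + e) + y <= (sumn (tandem z.1 z.2))%:R].
pose E2 := [set z : seq nat * seq (nat * seq nat) |
  (sumn (unzip1 z.2))%:R <= M%:R * (B - e) - y].
pose E3 := [set z : seq nat * seq (nat * seq nat) | exists2 i, (i < n.+1)%N &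
  (sumn (take i z.1))%:R <= i%:R * (A - e) - y].
pose E4 := [set z : seq nat * seq (nat * seq nat) | exists2 i, (i < n.+1)%N &
  exists c, reach (map (drop i) (unzip2 z.2)) (n - i) 0 c /\
    c%:R <= (n - i)%:R * (A1 - e) - M%:R * (B1 + e) - y *+ 2].
pose E5 := [set z : seq nat * seq (nat * seq nat) | exists2 m, (m < M)%N &
  m.+1%:R * (B + e) + y <= (sumn (take m.+1 (unzip1 z.2)))%:R].
pose E6 := [set z : seq nat * seq (nat * seq nat) | exists2 m, (m < M)%N &
  exists c, reach (drop m (unzip2 z.2)) n 0 c /\
    c%:R <= n%:R * (A2 - e) - (M - m)%:R * (B2 + e) - y *+ 2].
pose E7 := [set z : seq nat * seq (nat * seq nat) | exists2 i, (i < n.+1)%N &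
  i%:R * (s + e) + y <= (sumn (take i (head [::] (unzip2 z.2))))%:R].
have PE1 : (pr L E1 <= w%:E)%E.
  rewrite (@pr_joint_top U V M n burke
    [set us | n%:R * (A + e) + y <= (sumn us)%:R]).
  by have [/le_trans -> //] := h1 n y y0.
have PE2 : (pr L E2 <= w%:E)%E.
  rewrite (pr_joint_queues U V M n [set vs | (sumn vs)%:R <= M%:R * (B - e) - y]).
  by have [_ /le_trans -> //] := h2 M y y0.
have PE3 : (pr L E3 <= (n.+1%:R * w)%:E)%E.
  apply: pr_bigcup_le => i; rewrite ltnS => ilt.
  rewrite (pr_joint_arrivals U V M n
    [set us | (sumn (take i us))%:R <= i%:R * (A - e) - y]).
  rewrite /pr (iid_take _ (f := fun us =>
    (\1_([set us | (sumn us)%:R <= i%:R * (A - e) - y]) us)%:E))//.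
  by have [_ /le_trans -> //] := h1 i y y0.
have PE4 : (pr L E4 <= (n.+1%:R * (w *+ 2))%:E)%E.
  apply: pr_bigcup_le => i; rewrite ltnS => ilt.
  rewrite (pr_joint_env U V M n [set rows | exists c,
    reach (map (drop i) rows) (n - i) 0 c /\
    c%:R <= (n - i)%:R * (A1 - e) - M%:R * (B1 + e) - y *+ 2]).
  rewrite (pr_env_drop M [set rows | exists c, reach rows (n - i) 0 c /\
    c%:R <= (n - i)%:R * (A1 - e) - M%:R * (B1 + e) - y *+ 2])//.
  by apply: le_trans (h4 (n - i)%N M y y0) _; rewrite lee_fin lerMn2r w4 orbT.
have PE5 : (pr L E5 <= (M%:R * w)%:E)%E.
  apply: pr_bigcup_le => m mM.
  rewrite (pr_joint_queues U V M n
    [set vs | m.+1%:R * (B + e) + y <= (sumn (take m.+1 vs))%:R]).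
  rewrite /pr (iid_take _ (f := fun vs =>
    (\1_([set vs | m.+1%:R * (B + e) + y <= (sumn vs)%:R]) vs)%:E))//.
  by have [/le_trans -> //] := h2 m.+1 y y0.
have PE6 : (pr L E6 <= (M%:R * (w *+ 2))%:E)%E.
  apply: pr_bigcup_le => m mM.
  rewrite (pr_joint_env U V M n [set rows | exists c,
    reach (drop m rows) n 0 c /\
    c%:R <= n%:R * (A2 - e) - (M - m)%:R * (B2 + e) - y *+ 2]).
  rewrite (pr_env_drop_rows n [set rows | exists c, reach rows n 0 c /\
    c%:R <= n%:R * (A2 - e) - (M - m)%:R * (B2 + e) - y *+ 2]) 1?ltnW//.
  by apply: le_trans (h5 n (M - m)%N y y0) _; rewrite lee_fin lerMn2r w5 orbT.
have PE7 : (pr L E7 <= (n.+1%:R * w)%:E)%E.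
  apply: pr_bigcup_le => i; rewrite ltnS => ilt.
  rewrite (pr_joint_env U V M n
    [set rows | i%:R * (s + e) + y <= (sumn (take i (head [::] rows)))%:R]).
  rewrite (pr_env_first N n
    [set ss | i%:R * (s + e) + y <= (sumn (take i ss))%:R]).
  rewrite /pr (iid_take _ (f := fun ss =>
    (\1_([set ss | i%:R * (s + e) + y <= (sumn ss)%:R]) ss)%:E))//.
  by have [/le_trans -> //] := h3 i y y0.
rewrite -(pr_joint_env U V).
have := pr_setU_le PE1 (pr_setU_le PE2 (pr_setU_le PE3 (pr_setU_le PE4
  (pr_setU_le PE5 (pr_setU_le PE6 PE7))))).
move=> PE; apply: (@le_trans _ _ _ _ _ _ (le_trans PE _)); last first.
  rewrite lee_fin [expR _](_ : _ = w); last by rewrite /w /y mulrA.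
  have := ler_wpM2r w0 nx1; have := mulr_ge0 w0 N_ge0.
  have := mulr_ge0 (ltW x_gt0) w0; have := w0; rewrite /M -!natr1.
  clear; lra.
apply: (pr_le_on (@carried_joint U V M n)) => -[us xs].
move=> /and3P[/= /eqP szu /eqP szx ax] bad.
have [?|/negP] := pselect (E1 (us, xs)); [by left|rewrite -ltNge /= => n1; right].
have [?|/negP] := pselect (E2 (us, xs)); [by left|rewrite -ltNge /= => n2; right].
have [?|n3] := pselect (E3 (us, xs)); [by left|right].
have [?|n4] := pselect (E4 (us, xs)); [by left|right].
have [?|n5] := pselect (E5 (us, xs)); [by left|right].
have [?|n6] := pselect (E6 (us, xs)); [by left|right].
apply: contrapT => n7.
have {}n3 i : (i <= n)%N -> i%:R * (A - e) - y < (sumn (take i us))%:R.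
  by move=> ilt; rewrite ltNge; apply/negP => h; apply: n3; exists i.
have {}n4 i c : (i <= n)%N -> reach (unzip2 xs) n i c ->
    (n%:R - i%:R) * (A1 - e) - M%:R * (B1 + e) - y *+ 2 < c%:R.
  move=> ilt r; rewrite ltNge; apply/negP => h; apply: n4; exists i => //=.
  by exists c; rewrite natrB//; split => //; apply: reach_drop; rewrite addn0.
have {}n5 m : (m < M)%N ->
    (sumn (take m.+1 (unzip1 xs)))%:R < m.+1%:R * (B + e) + y.
  by move=> mM; rewrite ltNge; apply/negP => h; apply: n5; exists m.
have {}n6 m c : (m < M)%N -> reach (drop m (unzip2 xs)) n 0 c ->
    n%:R * (A2 - e) - (M%:R - m%:R) * (B2 + e) - y *+ 2 < c%:R.
  move=> mM r; rewrite ltNge; apply/negP => h; apply: n6; exists m => //=.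
  by exists c; rewrite natrB 1?ltnW.
have {}n7 i : (i <= n)%N ->
    (sumn (take i (head [::] (unzip2 xs))))%:R < i%:R * (s + e) + y.
  by move=> ilt; rewrite ltNge; apply/negP => h; apply: n7; exists i.
have yE : y = e * N%:R by [].
have ME : M%:R = N%:R + 1 :> R by rewrite natr1.
have eN : 0 <= e * N%:R by rewrite mulr_ge0// ltW.
have exN : 0 <= e * x * N%:R by rewrite !mulr_ge0// ltW.
have ekN := ler_wpM2r N_ge0 ek.
have enx := ler_wpM2l (ltW e0) nx1.
have nA := ler_wpM2r A0 nx1; have nA1 := ler_wpM2r A10 nx.
have nA2 := ler_wpM2r A20 nx.
have ck1 := ler_wpM2r N_ge0 k1; have ck2 := ler_wpM2r N_ge0 k2.
have ck3 := ler_wpM2r N_ge0 k3.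
have cr1 := ler_wpM2r N_ge0 crit1; have cr2 := ler_wpM2r N_ge0 crit2.
have K' : K <= k * N%:R := KN.
rewrite /K in K'.
have {}n1 : (sumn (tandem us xs))%:R < n%:R * (A + e) + e * N%:R by [].
have {}n2 : (N%:R + 1) * (B - e) - e * N%:R < (sumn (unzip1 xs))%:R.
  by rewrite -ME.
(* On the good event, [G] at the far corner is at most N (x A - B) up to the allowed error. *)
have T : (sumn (tandem us xs))%:R - (sumn (unzip1 xs))%:R <
    N%:R * (x * A - B) + A + k * N%:R + 2.
  clear -n1 n2 nA enx ekN exN eN e1 B0 N_ge0 e0; lra.
have [[i [c [r]]]|[m [c [mM r]]]] := tandem_ge_reach szu ax.
- have ilt := reach_le r; rewrite -(ler_nat R) !natrD => le.
  have i0 : 0 <= i%:R :> R by [].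
  (* If far, the boundary cost A i plus the bound with parameter [c1] for the remaining columns
     exceeds [T]. If near, the path is prolonged along the bottom row to the corner, against
     [bad]. *)
  have [far|near] := leP (dl * N%:R) i%:R.
    have h3' := n3 i ilt; have h4' := n4 i c ilt r.
    have G := ler_wpM2r (_ : 0 <= A - A1) far.
    have {}G : dl * N%:R * (A - A1) <= i%:R * (A - A1) by apply: G; rewrite subr_ge0 ltW.
    rewrite ME yE in h3' h4'.
    suff : false by [].
    clear -h3' h4' G le T cr1 ck2 K' A0 A10 B0 B10 A20 B20 s0 e0 e1 exN eN ekN
      enx nA1 N_ge0; lra.
  have [ss [rows E]] : exists ss rows, unzip2 xs = ss :: rows.
    by case: (xs) szx => // x' xs' _; exists x'.2, (unzip2 xs').
  have h7 := n7 i ilt; rewrite E /= in r bad h7.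
  have := bad _ (reach_from_left r); rewrite natrD => bad'.
  have se : 0 <= s + e by rewrite ltW// addr_gt0.
  have G := ler_wpM2r se (ltW near).
  have G' := ler_wpM2r N_ge0 (ler_wpM2l (ltW dl0) e1).
  have dlB := mulr_ge0 (mulr_ge0 (ltW dl0) N_ge0) B0.
  have dlN := mulr_ge0 (ltW dl0) N_ge0.
  have dlN' := congr1 ( *%R^~ N%:R) dlE.
  have epN : 0 <= ep * N%:R by rewrite mulr_ge0// ltW.
  have us0 : 0 <= (sumn (take i us))%:R :> R by [].
  rewrite yE in h7; rewrite /= in dlN'.
  suff : false by [].
  clear -h7 bad' G G' dlB dlN dlN' epN us0 le T ck1 K' A0 A10 B0 B10 A20 B20 s0
    e0 e1 exN eN ekN N_ge0; lra.
- rewrite -(ler_nat R) !natrD => le.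
  have m0 : 0 <= m%:R :> R by [].
  rewrite szx in mM; have h5' := n5 m mM; rewrite -natr1 yE in h5'.
  (* Climbing m rows on the left lowers [G] by about B m, less than the B2 m which the bound with
     parameter [c2] would need. A near exit is joined to the corner at no cost. *)
  have [far|near] := leP (dl * N%:R) m%:R.
    have h6' := n6 m c mM r.
    have G := ler_wpM2r (_ : 0 <= B2 - B) far.
    have {}G : dl * N%:R * (B2 - B) <= m%:R * (B2 - B) by apply: G; rewrite subr_ge0 ltW.
    rewrite ME yE in h6'.
    suff : false by [].
    clear -h5' h6' G le T cr2 ck3 K' A0 A10 B0 B10 A20 B20 s0 e0 e1 exN eN ekN
      enx nA2 N_ge0; lra.
  have bad' := bad _ (reach_from_bottom r).
  have Be : 0 <= B + e by rewrite addr_ge0// ltW.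
  have G := ler_wpM2r Be (ltW near).
  have G' := ler_wpM2r N_ge0 (ler_wpM2l (ltW dl0) e1).
  have dls := mulr_ge0 (mulr_ge0 (ltW dl0) N_ge0) (ltW s0).
  have dlN := mulr_ge0 (ltW dl0) N_ge0.
  have dlN' := congr1 ( *%R^~ N%:R) dlE.
  have epN : 0 <= ep * N%:R by rewrite mulr_ge0// ltW.
  rewrite /= in dlN'.
  suff : false by [].
  clear -h5' bad' G G' dls dlN dlN' epN le T ck1 K' A0 A10 B0 B10 A20 B20 s0
    e0 e1 exN eN ekN N_ge0; lra.
Qed.


End percolation_bounds.

(** * From first-passage times to paths in a grid *)

Section grids.
Variable Y : site -> nat.
Local Open Scope nat_scope.
Implicit Types (i j k m n M r : nat) (rs : seq nat).

Definition grid_row n r := [seq Y (j%:Z, r%:Z) | j <- iota 0 n].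
Definition grid_from r n M := [seq grid_row n r' | r' <- iota r M].
Definition grid n M := grid_from 0 n M.

Fixpoint cost i rs : nat :=
  if rs is r :: rs' then Y (i%:Z, r%:Z) + cost i.+1 rs' else 0.

Lemma cost_cat i rs rs' : cost i (rs ++ rs') = cost i rs + cost (i + size rs) rs'.
Proof.
elim: rs i => [|r rs IH] i /=; first by rewrite addn0.
by rewrite IH addnS addSn addnA.
Qed.

Lemma cost_nseq i m r n : i + m <= n ->
  cost i (nseq m r) = sumn (drop i (take (i + m) (grid_row n r))).
Proof.
move=> imn; rewrite /grid_row -map_take -map_drop take_iota drop_iota.
rewrite (minn_idPl imn) add0n addKn {imn}.
by elim: m i => [|m IH] i //=; rewrite IH.
Qed.

Lemma grid_fromS r n M : grid_from r n M.+1 = grid_row n r :: grid_from r.+1 n M.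
Proof. by []. Qed.

Lemma reach_rows r n M i c : i <= n -> reach (grid_from r n M) n i c ->
  exists rs, [/\ size rs = n - i, sorted leq rs,
    all (fun r' => r <= r' < r + M) rs & c = cost i rs].
Proof.
elim: M r i c => [|M IH] r i c.
  by move=> _ [-> ->]; exists [::]; rewrite subnn.
move=> _; rewrite grid_fromS => -[j [c' [/andP[ij jn] rc ->]]].
have [rs [sz so al ->]] := IH _ _ _ jn rc.
exists (nseq (j - i) r ++ rs); split.
- by rewrite size_cat size_nseq sz; lia.
- have al' : all (leq r) rs by apply: sub_all al => r' /=; lia.
  elim: (j - i) => //= m IHm; rewrite path_min_sorted// all_cat al' andbT.
  by apply/allP => r' /nseqP[->].
- rewrite all_cat; apply/andP; split; last by apply: sub_all al => r' /=; lia.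
  by apply/allP => r' /nseqP[->]; lia.
- by rewrite cost_cat size_nseq subnKC// (@cost_nseq _ _ _ n) subnKC.
Qed.

Lemma rows_reach r n M i rs : i + size rs = n -> sorted leq rs ->
  all (fun r' => r <= r' < r + M) rs -> reach (grid_from r n M) n i (cost i rs).
Proof.
elim: M r i rs => [|M IH] r i rs.
  by case: rs => [|r' rs] /=; [rewrite addn0|move=> _ _ /andP[]; lia].
move=> sz so al; rewrite grid_fromS.
(* The heights being sorted, those equal to [r] form the prefix before the first larger height; the
   path leaves the bottom row there. *)
pose m := find (fun r' => r < r') rs.
have msz : m <= size rs by exact: find_size.
have E : take m rs = nseq m r.
  apply: (@eq_from_nth _ 0); first by rewrite size_takel// size_nseq.
  move=> l; rewrite size_takel// => lm; rewrite nth_take// nth_nseq lm.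
  have := before_find 0 lm; have := allP al (nth 0 rs l).
  by rewrite mem_nth ?(leq_trans lm)// => /(_ erefl) /=; lia.
have al' : all (fun r' => r.+1 <= r' < r.+1 + M) (drop m rs).
  apply/(all_nthP 0) => l; rewrite size_drop nth_drop => lm.
  have lsz : m + l < size rs by lia.
  have hm : has (fun r' => r < r') rs by rewrite has_find -/m; lia.
  have := allP al (nth 0 rs (m + l)); rewrite mem_nth// => /(_ erefl) /=.
  have := nth_find 0 hm; rewrite -/m /= => h1.
  have := sorted_leq_nth leq_trans leqnn 0 so.
  move=> /(_ m (m + l)); rewrite !inE => /(_ _ lsz); lia.
have := IH r.+1 (i + m) (drop m rs).
rewrite size_drop => /(_ _ (drop_sorted _ so) al') rc.
exists (i + m), (cost (i + m) (drop m rs)); split; first lia.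
  by apply: rc; lia.
rewrite -(@cost_nseq _ _ _ n); last lia.
by rewrite -E -{2}(size_takel msz) -cost_cat cat_take_drop.
Qed.

Lemma reach_grid_shrink n n' M c : n <= n' -> reach (grid n' M) n' 0 c ->
  exists2 c', c' <= c & reach (grid n M) n 0 c'.
Proof.
move=> nn' /(reach_take nn')[c' cc' rc]; exists c' => //.
move: rc; rewrite min0n; congr (reach _ _ _ _).
rewrite /grid /grid_from -map_comp; apply: eq_map => r /=.
by rewrite /grid_row -map_take take_iota (minn_idPl nn').
Qed.

End grids.

Section paths.
Context {R : realType}.
Variables (Y : site -> nat) (s : site -> R).
Hypothesis sY : forall v, s v = (Y v)%:R.

Let cols i m : seq int := [seq 0 + j%:Z | j <- iota i m].

Lemma path_weight_cost i rs :
  path_weight s (zip (cols i (size rs)) [seq r%:Z | r <- rs]) = (cost Y i rs)%:R.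
Proof.
rewrite /path_weight; elim: rs i => [|r rs IH] i; first by rewrite big_nil.
by rewrite /= big_cons IH sY natrD add0r.
Qed.

Lemma directed_path_reach k N g : directed_path (0, 0) (k%:Z, N%:Z) g ->
  exists2 c, reach (grid Y k.+1 N.+1) k.+1 0 c & path_weight s g = c%:R.
Proof.
move=> /and3P[/eqP g1 g2 g3].
pose rs := [seq `|z|%N | z <- unzip2 g].
have zE : unzip2 g = [seq r%:Z | r <- rs].
  rewrite /rs -map_comp -[LHS]map_id; apply/eq_in_map => z zg /=.
  by rewrite gez0_abs//; have /andP[] := allP g3 _ zg.
have sz : size rs = k.+1.
  by rewrite !size_map -(size_map fst) g1 size_map size_iota /= addn0.
exists (cost Y 0 rs).
  apply: rows_reach; first by rewrite sz.
    move: g2; rewrite [X in sorted _ X]zE sorted_map.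
    by apply: sub_sorted => m n /=; rewrite lez_nat.
  move: g3; rewrite [X in all _ X]zE all_map; apply: sub_all => m /=.
  by rewrite lez_nat ltnS.
rewrite -path_weight_cost -zE -[in LHS](zip_unzip g) sz; congr (path_weight _ (zip _ _)).
by rewrite /unzip1 g1 /= addn0.
Qed.

Lemma reach_directed_path k N c : reach (grid Y k.+1 N.+1) k.+1 0 c ->
  exists2 g, directed_path (0, 0) (k%:Z, N%:Z) g & path_weight s g = c%:R.
Proof.
move=> /(reach_rows (leq0n _))[rs []]; rewrite subn0 => sz so al ->.
exists (zip (cols 0 (size rs)) [seq r%:Z | r <- rs]); last exact: path_weight_cost.
have szc : size (cols 0 (size rs)) = size [seq r%:Z | r <- rs].
  by rewrite !size_map size_iota.
apply/and3P; split.
- by rewrite [map _ _](@unzip1_zip _ _ _ _) ?szc// sz /= addn0.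
- rewrite [map _ _](@unzip2_zip _ _ _ _) ?szc// sorted_map.
  by apply: sub_sorted so => m n /=; rewrite lez_nat.
- rewrite [map _ _](@unzip2_zip _ _ _ _) ?szc// all_map.
  by apply: sub_all al => m /=; rewrite lez_nat ltnS.
Qed.

Lemma fpt_reach k N :
  (exists2 c, reach (grid Y k.+1 N.+1) k.+1 0 c &
    fpt s (0, 0) (k%:Z, N%:Z) = c%:R) /\
  (forall c, reach (grid Y k.+1 N.+1) k.+1 0 c ->
    fpt s (0, 0) (k%:Z, N%:Z) <= c%:R).
Proof.
have [[g gp fE] le] := @fpt_min R s (0, 0) (k%:Z, N%:Z) isT isT; split.
  by have [c rc gc] := directed_path_reach gp; exists c; rewrite // fE.
by move=> c /reach_directed_path[g' /le le' <-].
Qed.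

End paths.

(** * Transfer to the probability space *)

Section transfer.
Context d (T : measurableType d) (R : realType) (P : probability T R).
Variables (q b : R) (S : site -> {RV P >-> R}).
Hypotheses (q01 : 0 < q < 1) (b01 : 0 < b < 1).
Hypothesis hindep : mutually_independent S.
Hypothesis hdist : forall v, ber_geom q b (S v).
Let L : law (R := R) nat := service_law q01 b01.

(** Requiring natural values makes this a countable union of level sets, measurable for every
    [B]. *)
Definition samples (J : seq site) (B : set (seq nat)) : set T :=
  [set w | exists2 ks, [seq S v w | v <- J] = [seq k%:R | k <- ks] & B ks].

Lemma samples_cons v J B : samples (v :: J) B =
  \bigcup_k ([set w | S v w = k%:R] `&` samples J [set ks | B (k :: ks)]).
Proof.
apply/seteqP; split => [w [[|k ks] //= [Sv E] Bk]|w [k _ [/= Sv [ks E Bk]]]].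
  by exists k => //; split => //; exists ks.
by exists (k :: ks) => //=; rewrite Sv E.
Qed.

Lemma measurable_level v (r : R) : measurable [set w | S v w = r].
Proof.
rewrite [X in measurable X](_ : _ = setT `&` S v @^-1` [set r]); last first.
  by rewrite setTI.
exact: (measurable_funPT (S v)).
Qed.

Lemma measurable_samples J B : measurable (samples J B).
Proof.
elim: J B => [|v J IH] B.
  have [B0|B0] := pselect (B [::]).
    rewrite [X in measurable X](_ : _ = setT) //.
    by apply/seteqP; split => // w _; exists [::].
  rewrite [X in measurable X](_ : _ = set0) //.
  by apply/seteqP; split => // w [[|] //].
rewrite samples_cons; apply: bigcupT_measurable => k; apply: measurableI => //.
exact: measurable_level.
Qed.

Lemma prob_level v k : P [set w | S v w = k%:R] = (bg q b k)%:E.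
Proof.
have [P0 Pk] := hdist v; case: k => [|k]; first exact: P0.
by rewrite Pk// subSS subn0.
Qed.

Definition constraint (J : seq site) (A : site -> set R) : set T :=
  [set w | forall i, i \in J -> A i (S i w)].

Lemma measurable_constraint J A : (forall i, measurable (A i)) ->
  measurable (constraint J A).
Proof.
move=> mA; elim: J => [|v J IH].
  by rewrite (_ : constraint _ _ = setT)//; apply/seteqP; split.
rewrite (_ : constraint _ _ = (setT `&` S v @^-1` A v) `&` constraint J A).
  by apply: measurableI => //; exact: (measurable_funPT (S v)).
apply/seteqP; split => [w hA|w [[_ /= Av] hA] i].
  split; first by split => //; apply: hA; rewrite mem_head.
  by move=> i iJ; apply: hA; rewrite inE iJ orbT.
by rewrite inE => /predU1P[->//|]; exact: hA.
Qed.

(* The prior constraint on sites outside J lets the induction peel off the head of J. *)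
Lemma prob_constraint_samples J0 J A B : uniq (J0 ++ J) ->
  (forall i, measurable (A i)) ->
  P (constraint J0 A `&` samples J B) =
  (P (constraint J0 A) * pr (iid L (size J)) B)%E.
Proof.
elim: J J0 A B => [|v J IH] J0 A B uJ mA.
  rewrite /pr /= indicE.
  have [B0|B0] := pselect (B [::]).
    rewrite mem_set// mule1 (_ : samples _ _ = setT) ?setIT//.
    by apply/seteqP; split => // w _; exists [::].
  rewrite memNset// mule0 (_ : samples _ _ = set0) ?setI0 ?measure0//.
  by apply/seteqP; split => // w [[|] //].
have uvJ0 : uniq ((v :: J0) ++ J).
  by rewrite -[_ ++ _]/([:: v] ++ J0 ++ J) uniq_catCA.
pose A' k i := if i == v then [set k%:R : R] else A i.
have mA' k i : measurable (A' k i) by rewrite /A'; case: ifP.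
have vJ0 : v \notin J0 by move: uvJ0; rewrite /= mem_cat negb_or => /andP[/andP[]].
have CA' k : constraint J0 A `&` [set w | S v w = k%:R] =
    constraint (v :: J0) (A' k).
  apply/seteqP; split => [w [/= hA Sv] i|w hA].
    rewrite inE /A'; case: eqVneq => [-> //|_ /= iJ]; exact: hA.
  split => /= [i iJ|].
    have := hA i; rewrite inE iJ orbT /A' => /(_ erefl).
    by case: eqVneq => // iv; rewrite -iv iJ in vJ0.
  by have := hA v; rewrite inE eqxx /A' eqxx; apply.
have PA' k : P (constraint (v :: J0) (A' k)) =
    (P (constraint J0 A) * (bg q b k)%:E)%E.
  have /= /andP[_ uJ0] : uniq (v :: J0) by move: uvJ0; rewrite cat_uniq => /andP[].
  rewrite /constraint hindep//= ?vJ0// hindep// big_cons /A' eqxx.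
  rewrite [X in (X * _)%E]prob_level muleC; congr (_ * _)%E.
  rewrite big_seq [RHS]big_seq; apply: eq_bigr => i iJ.
  by case: eqVneq => // iv; rewrite -iv iJ in vJ0.
rewrite samples_cons setI_bigcupr.
rewrite measure_semi_bigcup//=.
- transitivity (\sum_(k <oo) P (constraint J0 A) *
      ((bg q b k)%:E * pr (iid L (size J)) [set ks | B (k :: ks)]))%E.
    by apply: eq_eseriesr => k _; rewrite setIA CA' IH// PA' muleA.
  have fC : P (constraint J0 A) \is a fin_num.
    exact/fin_num_measure/measurable_constraint.
  rewrite -(fineK fC) nneseriesZl// => k _.
  by rewrite mule_ge0 ?pr_ge0// lee_fin bg_ge0// ?unit_itvW ?unit_itvWr.
- move=> k; apply: measurableI; first exact: measurable_constraint.
  by apply: measurableI; [exact: measurable_level|exact: measurable_samples].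
- apply/trivIsetP => i j _ _ ij; apply/seteqP; split => // w.
  move=> [[_ [/= Si _]] [_ [/= Sj _]]].
  by move: ij; rewrite -(eqr_nat R) -Si -Sj eqxx.
- apply: bigcupT_measurable => k.
  apply: measurableI; first exact: measurable_constraint.
  by apply: measurableI; [exact: measurable_level|exact: measurable_samples].
Qed.

Lemma prob_samples J B : uniq J -> P (samples J B) = pr (iid L (size J)) B.
Proof.
move=> uJ; rewrite -[LHS]mul1e -(@probability_setT _ _ _ P).
have := @prob_constraint_samples [::] J (fun=> setT) B uJ (fun=> measurableT).
rewrite (_ : constraint [::] _ = setT) ?setTI ?probability_setT ?mul1e//.
by apply/seteqP; split.
Qed.

Lemma map_cst_nseq X Y (s : seq X) (y : Y) : [seq y | _ <- s] = nseq (size s) y.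
Proof. by elim: s => //= _ s ->. Qed.

Definition sites n M : seq (seq site) :=
  [seq [seq (j%:Z, r%:Z) | j <- iota 0 n] | r <- iota 0 M].

Lemma sites_uniq n M : uniq (flatten (sites n M)).
Proof.
apply: (allpairs_uniq (iota_uniq 0 M) (iota_uniq 0 n)).
by move=> [r j] [r' j'] _ _ /= [-> ->].
Qed.

Lemma iid_reshape X (K : law (R := R) X) n M f : (forall x, (0 <= f x)%E) ->
  iid K (M * n) (fun ks => f (reshape (nseq M n) ks)) = iid (iid K n) M f.
Proof.
elim: M f => [//|M IH] f f0; rewrite mulSn iid_cat /=.
apply: (eq_carried (carried_iid (carriedT K))) => [x|x|x /andP[/eqP szx _]].
- by apply: expect_ge0 => ys; exact: f0.
- by apply: expect_ge0 => ys; exact: f0.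
rewrite -IH; last by move=> ys; exact: f0.
by apply: eq_expect => ys; rewrite -szx take_size_cat// drop_size_cat.
Qed.

Definition env_event n M (B : set (seq (seq nat))) : set T :=
  samples (flatten (sites n M)) [set ks | B (reshape (nseq M n) ks)].

Lemma prob_env n M B : P (env_event n M B) = pr (env_law q01 b01 M n) B.
Proof.
rewrite /env_event prob_samples ?sites_uniq//.
rewrite size_flatten (_ : shape _ = nseq M n); last first.
  have size_row r : size [seq (j%:Z, r%:Z) | j <- iota 0 n] = n.
    by rewrite size_map size_iota.
  rewrite /sites /shape -map_comp (eq_map (g := fun=> n))//.
  by rewrite map_cst_nseq size_iota.
rewrite sumn_nseq mulnC.
by apply: (@iid_reshape _ L n M (fun rows => (\1_B rows)%:E)).
Qed.

Lemma env_event_grid n M B w Y : (forall v, S v w = (Y v)%:R) ->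
  B (grid Y n M) -> env_event n M B w.
Proof.
move=> SY BY; exists [seq Y v | v <- flatten (sites n M)].
  by rewrite -map_comp; apply: eq_map.
rewrite /= map_flatten (_ : map _ (sites n M) = grid Y n M); last first.
  by rewrite /sites -map_comp; apply: eq_map => r /=; rewrite -map_comp.
rewrite [reshape _ _](_ : _ = grid Y n M)//.
rewrite -[RHS]flattenK; congr (reshape _ _).
rewrite /grid /grid_from /shape -map_comp (eq_map (g := fun=> n)).
  by rewrite map_cst_nseq size_iota.
by move=> r /=; rewrite size_map size_iota.
Qed.

(** The prescribed masses at the naturals sum to 1, and there are countably many sites. *)
Lemma weights_are_naturals :
  {ae P, forall w, forall v, S v w = (Num.truncn (S v w))%:R}.
Proof.
have one v : {ae P, forall w, S v w = (Num.truncn (S v w))%:R}.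
  exists (~` \bigcup_k [set w | S v w = k%:R]).
  have mU : measurable (\bigcup_k [set w | S v w = k%:R]).
    by apply: bigcupT_measurable => k; exact: measurable_level.
  have PU : P (\bigcup_k [set w | S v w = k%:R]) = 1%E.
    rewrite measure_semi_bigcup//.
    - rewrite -(bg_sum1 (unit_itvW q01) (unit_itvWr b01)).
      by apply: eq_eseriesr => k _; exact: prob_level.
    - by move=> k; exact: measurable_level.
    - apply/trivIsetP => i j _ _ ij; apply/seteqP; split => // w [/= Si Sj].
      by move: ij; rewrite -(eqr_nat R) -Si -Sj eqxx.
  split; first exact: measurableC.
    by rewrite [LHS]probability_setC// PU subee.
  move=> w /= nS [k _ /= Sk]; apply: nS; rewrite Sk.
  by rewrite Num.Theory.natrK.
have : {ae P, forall w, forall k : nat,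
    if unpickle k is Some v then S v w = (Num.truncn (S v w))%:R else True}.
  apply: ae_foralln => k; case: (unpickle k) => [v|]; first exact: one.
  exact: aeW.
by apply: filterS => w h v; have := h (pickle v); rewrite pickleK.
Qed.

Lemma summable_linear_exp (C t : R) : 0 <= C -> 0 < t ->
  (\sum_(N <oo) (C * N.+1%:R * expR (- (t * N%:R)))%:E < +oo)%E.
Proof.
move=> C0 t0; pose z := expR (- (t / 2)); pose K := C * (1 + 2 / t).
have K0 : 0 <= K by rewrite mulr_ge0// addr_ge0// divr_ge0// ltW.
have z0 : 0 <= z by exact: expR_ge0.
have z1 : z < 1 by rewrite expR_lt1 oppr_lt0 divr_gt0.
apply: (@le_lt_trans _ _ (\sum_(N <oo) (K * z ^+ N)%:E)%E); last first.
  by rewrite nneseries_geometric ?ltry// z0.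
apply: lee_nneseries => [N _ _|N _].
  by rewrite lee_fin !mulr_ge0// expR_ge0.
rewrite lee_fin /K -!mulrA ler_wpM2l//.
have -> : expR (- (t * N%:R)) = z ^+ N * z ^+ N.
  by rewrite -exprMn -expRD -expRM_natr; congr expR; field.
rewrite mulrA ler_wpM2r ?exprn_ge0//.
have -> : z ^+ N = (expR (t / 2 * N%:R))^-1.
  by rewrite -expRN -expRM_natr mulNr.
rewrite ler_pdivrMr ?expR_gt0// mulrDl mul1r -natr1 addrC lerD//.
  by rewrite -expR0 ler_expR mulr_ge0// divr_ge0// ltW.
have := expR_ge1Dx (t / 2 * N%:R).
rewrite -(ler_pM2l (_ : 0 < 2 / t)) ?divr_gt0//; apply: le_trans.
rewrite mulrDr mulr1 (_ : 2 / t * (t / 2 * N%:R) = N%:R).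
  by rewrite lerDr divr_ge0// ltW.
by field; lra.
Qed.

(** Borel-Cantelli: the probabilities are summable, so almost surely only finitely many of the
    events occur. *)
Lemma eventually_grid (n : nat -> nat) (B : nat -> set (seq (seq nat))) C t N0 :
  0 < t ->
  (forall N, (N0 <= N)%N -> (pr (env_law q01 b01 N.+1 (n N)) (B N) <=
     (C * N.+1%:R * expR (- (t * N%:R)))%:E)%E) ->
  {ae P, forall w, exists N1, forall N, (N1 <= N)%N ->
     ~ B N (grid (fun v => Num.truncn (S v w)) (n N) N.+1)}.
Proof.
move=> t0 bound.
pose E N := if (N0 <= N)%N then env_event (n N) N.+1 (B N) else set0.
have mE N : measurable (E N).
  by rewrite /E; case: ifP => // _; exact: measurable_samples.
have sumE : (\sum_(N <oo) P (E N) < +oo)%E.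
  apply: le_lt_trans (summable_linear_exp (normr_ge0 C) t0).
  apply: lee_nneseries => N *; first exact: measure_ge0.
  rewrite /E; case: leqP => NN; last by rewrite measure0 lee_fin !mulr_ge0// expR_ge0.
  rewrite prob_env; apply: le_trans (bound N NN) _; rewrite lee_fin.
  by rewrite -!mulrA ler_wpM2r ?ler_norm// mulr_ge0// expR_ge0.
have null : {ae P, forall w, ~ lim_sup_set E w}.
  exists (lim_sup_set E); split.
  - apply: bigcapT_measurable => k; apply: bigcup_measurable => *; exact: mE.
  - exact: lim_sup_set_cvg0.
  - by move=> w /= /contrapT.
apply: filterS2 weights_are_naturals null => w SY nE.
have [N1 hN1] : exists N1, forall N, (N1 <= N)%N -> ~ E N w.
  apply: contrapT => /forallNP h; apply: nE => k _.
  have /existsNP[N /not_implyP[kN /contrapT EN]] := h k.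
  by exists N.
exists (maxn N0 N1) => N; rewrite geq_max => /andP[NN0 NN1] BN.
apply: (hN1 N NN1); rewrite /E NN0.
exact: env_event_grid SY BN.
Qed.

End transfer.

(** * The variational problem *)

Section variational.
Context {R : realType}.
Variables q b : R.
Hypotheses (q01 : 0 < q < 1) (b01 : 0 < b < 1).
Implicit Types (a u x p : R).

Let A := mean_arrival q b.
Let B := mean_queue b.
Let D := den q b.
Definition gain x a := x * A a - B a.

(** The first factor is positive, so the sign of the gain is that of the last one; positive values
    occur exactly when q x > 1 - q. *)
Lemma gainE x a : b < a < 1 -> gain x a =
  b * (1 - a) / (a * D a * (a - b)) *
    ((a - b) * (q * x - (1 - q)) - (1 - a) * b).
Proof.
move=> ha; have D0 := den_gt0 q01 b01 ha.
have /andP[q0 q1] := q01; have /andP[b0 b1] := b01; have /andP[ba a1] := ha.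
have -> : (a - b) * (q * x - (1 - q)) - (1 - a) * b = (a - b) * (q * x) - D a.
  by rewrite /D denE; ring.
by rewrite /gain /A /B /D /mean_arrival /mean_queue; field; lra.
Qed.

Lemma den_ge a : b < a < 1 -> (1 - q) * b * (1 - b) <= D a.
Proof.
move=> /andP[ba a1].
have /andP[q0 q1] := q01; have /andP[b0 b1] := b01.
rewrite /D denE.
have : 0 <= (1 - a) * (b * q) by rewrite !mulr_ge0//; lra.
have : 0 <= (a - b) * ((1 - q) * (1 - b)) by rewrite !mulr_ge0//; lra.
lra.
Qed.

(* Difference quotients of A and B between a and u; their values at u = a are
   the derivatives. *)
Let slopeA a u := (1 - b) * (1 - q) * (1 - b - q) / (D a * D u) - (a * u)^-1.
Let slopeB a u := (a * u)^-1 - (1 - b) / ((a - b) * (u - b)).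

Lemma arrival_slope a u : b < a < 1 -> b < u < 1 ->
  A u - A a = (u - a) * slopeA a u.
Proof.
move=> ha hu; have Da := den_gt0 q01 b01 ha; have Du := den_gt0 q01 b01 hu.
have /andP[b0 b1] := b01; have /andP[ba a1] := ha; have /andP[bu u1] := hu.
rewrite /A /slopeA /mean_arrival /D; rewrite /den in Da Du *; field; lra.
Qed.

Lemma queue_slope a u : b < a < 1 -> b < u < 1 ->
  B u - B a = (u - a) * slopeB a u.
Proof.
move=> /andP[ba a1] /andP[bu u1]; have /andP[b0 b1] := b01.
by rewrite /B /slopeB /mean_queue; field; lra.
Qed.

(** Both D v > v (1 - b) (1 - q) and 1 - b - q < (1 - b) (1 - q) hold, so the first fraction stays
    below 1 / (a u). Hence [A] is strictly decreasing. *)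
Lemma slopeA_lt0 a u : b < a < 1 -> b < u < 1 -> slopeA a u < 0.
Proof.
move=> ha hu; have Da := den_gt0 q01 b01 ha; have Du := den_gt0 q01 b01 hu.
have /andP[b0 b1] := b01; have /andP[ba a1] := ha; have /andP[bu u1] := hu.
have /andP[q0 q1] := q01.
have a0 := lt_trans b0 ba; have u0 := lt_trans b0 bu.
pose E := (1 - b) * (1 - q); have E0 : 0 < E by rewrite mulr_gt0// subr_gt0.
have DE v : D v = v * E + b * q * (1 - v) by rewrite /D /den /E; ring.
have aE : a * E < D a.
  by rewrite DE ltrDl !mulr_gt0// subr_gt0.
have uE : u * E < D u.
  by rewrite DE ltrDl !mulr_gt0// subr_gt0.
rewrite /slopeA subr_lt0 ltr_pdivrMr ?mulr_gt0// [ltRHS]mulrC ltr_pdivlMr ?mulr_gt0//.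
have : a * E * (u * E) < D a * D u.
  by apply: ltr_pM => //; rewrite ltW// mulr_gt0.
apply: le_lt_trans; rewrite -/E.
have -> : a * E * (u * E) = E * E * (a * u) by ring.
rewrite ler_pM2r ?mulr_gt0// ler_pM2l// /E.
have : 0 < b * q by rewrite mulr_gt0.
lra.
Qed.

Lemma slopeB_lt0 a u : b < a < 1 -> b < u < 1 -> slopeB a u < 0.
Proof.
move=> /andP[ba a1] /andP[bu u1]; have /andP[b0 b1] := b01.
have a0 := lt_trans b0 ba; have u0 := lt_trans b0 bu.
have ab : a - b < a * (1 - b) by have : 0 < b * (1 - a); [rewrite mulr_gt0|]; lra.
have ub : u - b < u * (1 - b) by have : 0 < b * (1 - u); [rewrite mulr_gt0|]; lra.
have a'0 : 0 < a - b by lra.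
have u'0 : 0 < u - b by lra.
rewrite /slopeB subr_lt0 ltr_pdivlMr ?mulr_gt0// [ltLHS]mulrC ltr_pdivrMr ?mulr_gt0//.
have : (a - b) * (u - b) < a * (1 - b) * (u * (1 - b)).
  by apply: ltr_pM => //; lra.
move/lt_le_trans; apply.
have -> : a * (1 - b) * (u * (1 - b)) = (1 - b) * (a * u) * (1 - b) by ring.
by rewrite ler_piMr ?mulr_ge0//; lra.
Qed.

Lemma den_continuous : continuous D.
Proof.
move=> u; apply: cvgD; last exact: cvg_cst.
by apply: cvgM; [exact: cvg_id|exact: cvg_cst].
Qed.

Lemma slopeA_continuous a : b < a < 1 -> {for a, continuous (slopeA a)}.
Proof.
move=> ha; have Da := den_gt0 q01 b01 ha.
have /andP[b0 b1] := b01; have /andP[ba a1] := ha.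
have a0 := lt_trans b0 ba.
apply: cvgB.
  apply: cvgM; first exact: cvg_cst.
  apply: cvgV; first by rewrite gt_eqF// mulr_gt0.
  by apply: cvgM; [exact: cvg_cst|exact: den_continuous].
apply: cvgV; first by rewrite gt_eqF// mulr_gt0.
by apply: cvgM; [exact: cvg_cst|exact: cvg_id].
Qed.

Lemma slopeB_continuous a : b < a < 1 -> {for a, continuous (slopeB a)}.
Proof.
move=> /andP[ba a1]; have /andP[b0 b1] := b01.
have a0 := lt_trans b0 ba.
apply: cvgB.
  apply: cvgV; first by rewrite gt_eqF// mulr_gt0.
  by apply: cvgM; [exact: cvg_cst|exact: cvg_id].
apply: cvgM; first exact: cvg_cst.
apply: cvgV; first by rewrite gt_eqF// mulr_gt0// subr_gt0.
apply: cvgM; first exact: cvg_cst.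
by apply: cvgB; [exact: cvg_id|exact: cvg_cst].
Qed.

Lemma gain_continuous x u : b < u <= 1 -> {for u, continuous (gain x)}.
Proof.
move=> /andP[bu u1]; have /andP[b0 b1] := b01; have /andP[q0 q1] := q01.
have u0 := lt_trans b0 bu.
have Du : 0 < D u.
  rewrite /D denE ltr_wpDl ?mulr_ge0 ?subr_ge0//; first exact: ltW.
  by rewrite mulr_gt0 ?subr_gt0.
have cB : (fun v => 1 - v) @ u --> 1 - u.
  by apply: cvgB; [exact: cvg_cst|exact: cvg_id].
apply: cvgB.
  apply: cvgM; first exact: cvg_cst.
  apply: cvgM; first by apply: cvgM; [exact: cvg_cst|].
  apply: cvgV; first by rewrite gt_eqF// mulr_gt0.
  by apply: cvgM; [exact: den_continuous|exact: cvg_id].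
apply: cvgM; first by apply: cvgM; [exact: cvg_cst|].
apply: cvgV; first by rewrite gt_eqF// mulr_gt0// subr_gt0.
apply: cvgM; first exact: cvg_id.
by apply: cvgB; [exact: cvg_id|exact: cvg_cst].
Qed.

Lemma near_right (Q : R -> Prop) a c : a < c -> (\forall u \near a, Q u) ->
  exists u, [/\ a < u, u < c & Q u].
Proof.
move=> ac /nbhs_ballP[e /= e0 eQ].
have m0 : 0 < Num.min e (c - a) by rewrite lt_min e0 subr_gt0.
exists (a + Num.min e (c - a) / 2).
have m1 : Num.min e (c - a) <= e by rewrite ge_min lexx.
have m2 : Num.min e (c - a) <= c - a by rewrite ge_min lexx orbT.
split; [lra|lra|apply: eQ].
rewrite /ball /= opprD addrA subrr sub0r normrN gtr0_norm; lra.
Qed.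

Lemma near_left (Q : R -> Prop) a c : c < a -> (\forall u \near a, Q u) ->
  exists u, [/\ c < u, u < a & Q u].
Proof.
move=> ac /nbhs_ballP[e /= e0 eQ].
have m0 : 0 < Num.min e (a - c) by rewrite lt_min e0 subr_gt0.
exists (a - Num.min e (a - c) / 2).
have m1 : Num.min e (a - c) <= e by rewrite ge_min lexx.
have m2 : Num.min e (a - c) <= a - c by rewrite ge_min lexx orbT.
split; [lra|lra|apply: eQ].
rewrite /ball /= opprB addrC subrK gtr0_norm; lra.
Qed.

(** * First-order conditions at a maximizer of the gain *)

Section maximizer.
Variables (x a : R).
Hypotheses (ha : b < a < 1).
Hypothesis amax : forall u, b < u < 1 -> gain x u <= gain x a.

Let slope u := x * slopeA a u - slopeB a u.

Lemma gain_slope u : b < u < 1 -> gain x u - gain x a = (u - a) * slope u.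
Proof.
move=> hu; rewrite /slope mulrBr mulrCA -arrival_slope// -queue_slope//.
by rewrite /gain; ring.
Qed.

Lemma slope_continuous : {for a, continuous slope}.
Proof.
apply: cvgB; last exact: slopeB_continuous.
by apply: cvgM; [exact: cvg_cst|exact: slopeA_continuous].
Qed.

(** A nonzero slope keeps its sign near [a], and a small move in the corresponding direction would
    increase the gain. *)
Lemma slope_eq0 : slope a = 0.
Proof.
have /andP[ba a1] := ha.
have [lt0|gt0|//] := ltgtP (slope a) 0.
- have : \forall u \near a, slope u < 0.
    exact: (cvgr_lt (slope a) slope_continuous).
  move=> /(near_left ba)[u [bu ua su]].
  have hu : b < u < 1 by rewrite bu (lt_trans ua).
  have := amax hu; rewrite -subr_le0 gain_slope// leNgt.
  by rewrite nmulr_rgt0 ?su// subr_lt0.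
- have : \forall u \near a, 0 < slope u.
    exact: (cvgr_gt (slope a) slope_continuous).
  move=> /(near_right a1)[u [au u1 su]].
  have hu : b < u < 1 by rewrite u1 (lt_trans ba).
  have := amax hu; rewrite -subr_le0 gain_slope// leNgt.
  by rewrite mulr_gt0// subr_gt0.
Qed.

(** At [a] the slope of the gain vanishes and that of [A] is negative, so
    [slope u - dl * slopeA a u] is positive nearby; multiplying by u - a > 0 gives the claim. *)
Lemma maximizer_smaller_arrival dl : 0 < dl -> exists u,
  [/\ b < u < 1, A u < A a & gain x a - gain x u <= dl * (A a - A u)].
Proof.
move=> dl0; have /andP[ba a1] := ha.
have : \forall u \near a, 0 < slope u - dl * slopeA a u.
  have c : {for a, continuous (fun u => slope u - dl * slopeA a u)}.
    apply: cvgB; first exact: slope_continuous.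
    by apply: cvgM; [exact: cvg_cst|exact: slopeA_continuous].
  apply: (cvgr_gt _ c); rewrite slope_eq0 sub0r oppr_gt0 pmulr_rlt0//.
  exact: slopeA_lt0.
move=> /(near_right a1)[u [au u1 su]].
have hu : b < u < 1 by rewrite u1 (lt_trans ba).
have ua0 : 0 < u - a by rewrite subr_gt0.
exists u; split => //.
  by rewrite -subr_lt0 arrival_slope// pmulr_rlt0// slopeA_lt0.
have := gain_slope hu; have /= := congr1 ( *%R dl) (arrival_slope ha hu).
have := mulr_gt0 ua0 su; lra.
Qed.

Lemma maximizer_larger_queue dl : 0 < dl -> exists u,
  [/\ b < u < 1, B a < B u & gain x a - gain x u <= dl * (B u - B a)].
Proof.
move=> dl0; have /andP[ba a1] := ha.
have : \forall u \near a, slope u + dl * slopeB a u < 0.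
  have c : {for a, continuous (fun u => slope u + dl * slopeB a u)}.
    apply: cvgD; first exact: slope_continuous.
    by apply: cvgM; [exact: cvg_cst|exact: slopeB_continuous].
  apply: (cvgr_lt _ c); rewrite slope_eq0 add0r pmulr_rlt0//.
  exact: slopeB_lt0.
move=> /(near_left ba)[u [bu ua su]].
have hu : b < u < 1 by rewrite bu (lt_trans ua).
have ua0 : u - a < 0 by rewrite subr_lt0.
exists u; split => //.
  by rewrite -subr_gt0 queue_slope// nmulr_rgt0// slopeB_lt0.
have := gain_slope hu; have /= := congr1 ( *%R dl) (queue_slope ha hu).
have : 0 < (u - a) * (slope u + dl * slopeB a u) by rewrite nmulr_rgt0.
lra.
Qed.

End maximizer.

(** The gain is positive at some [a0], nonpositive near [b] and zero at 1, so its maximum over a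
    compact interval is attained inside. *)
Lemma gain_maximizer x : 0 < q * x - (1 - q) -> exists a,
  b < a < 1 /\ forall u, b < u < 1 -> gain x u <= gain x a.
Proof.
set w := q * x - (1 - q) => w0.
have /andP[q0 q1] := q01; have /andP[b0 b1] := b01.
have x0 : 0 < x by rewrite -(pmulr_rgt0 x q0); rewrite /w in w0; lra.
(* At 1 - t the last factor of [gainE] is (1 - b) w - t (b + w), which this [t] makes half of (1 -
   b) w. *)
pose t := (1 - b) * w / (2 * (b + w)).
have tE : t * (2 * (b + w)) = (1 - b) * w by rewrite /t mulfVK// gt_eqF//; lra.
have t0 : 0 < t by rewrite divr_gt0 ?mulr_gt0//; lra.
have t1 : t < 1 - b.
  rewrite ltr_pdivrMr; last lra.
  by rewrite ltr_pM2l; lra.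
pose a0 := 1 - t.
have ha0 : b < a0 < 1 by rewrite /a0; lra.
have ga0 : 0 < gain x a0.
  have D0 := den_gt0 q01 b01 ha0; have /andP[ba a1] := ha0.
  rewrite gainE// -/w mulr_gt0//.
    by rewrite divr_gt0 ?mulr_gt0 ?subr_gt0//; lra.
  have := mulr_gt0 t0 b0; have := mulr_gt0 t0 w0; rewrite /a0; lra.
pose d0 := (1 - q) * b * (1 - b).
have d00 : 0 < d0 by rewrite !mulr_gt0// subr_gt0.
(* Below b + eta one has (u - b) q x <= d0 <= D u, so the gain is nonpositive; the second bound
   keeps [a0] in the compact interval. *)
pose eta := Num.min (d0 / (q * x)) (a0 - b).
have eta0 : 0 < eta by rewrite lt_min divr_gt0 ?mulr_gt0// subr_gt0; lra.
have eta1 : eta * (q * x) <= d0.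
  by rewrite -ler_pdivlMr ?mulr_gt0// ge_min lexx.
have eta2 : eta <= a0 - b by rewrite ge_min lexx orbT.
have low u : b < u < 1 -> u < b + eta -> gain x u <= 0.
  move=> hu ue; have Du := den_gt0 q01 b01 hu; have dge := den_ge hu.
  have /andP[bu u1] := hu.
  rewrite gainE// pmulr_rle0; last first.
    by rewrite divr_gt0 ?mulr_gt0 ?subr_gt0//; lra.
  have -> : (u - b) * (q * x - (1 - q)) - (1 - u) * b = (u - b) * (q * x) - D u.
    by rewrite /D denE; ring.
  rewrite subr_le0; apply: le_trans dge; apply: le_trans eta1.
  by rewrite ler_pM2r ?mulr_gt0//; lra.
have le1 : b + eta <= 1 by rewrite /a0 in eta2; lra.
have cont : {within `[b + eta, 1], continuous (gain x)}.
  apply: continuous_in_subspaceT => u /set_mem /=; rewrite in_itv /= => /andP[bu u1].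
  by apply: gain_continuous; rewrite u1 andbT; lra.
have [a /itvP aI amax] := EVT_max le1 cont.
have max0 : gain x a0 <= gain x a.
  by apply: amax; rewrite in_itv /=; rewrite /a0 in eta2 *; lra.
have g1 : gain x 1 = 0 by rewrite /gain /A /B /mean_arrival /mean_queue; ring.
have ba : b < a by apply: (@lt_le_trans _ _ (b + eta)); [lra|rewrite aI].
have an1 : a != 1 by apply: contraTneq max0 => ->; rewrite g1 -ltNge.
exists a; split; first by rewrite ba lt_neqAle an1 aI.
move=> u hu; have [ue|ue] := ltP u (b + eta).
  by apply: le_trans (low u hu ue) _; exact: ltW (lt_le_trans ga0 max0).
by apply: amax; rewrite in_itv /= ue; have /andP[_ /ltW] := hu.
Qed.

(** The bound is uniform in [a] and vanishes at the critical slope, so the maximal gain just above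
    that slope is small. *)
Lemma gain_le x a : b < a < 1 -> 0 <= q * x - (1 - q) ->
  gain x a <= (q * x - (1 - q)) / ((1 - q) * b * (1 - b)).
Proof.
move=> ha; set w := q * x - (1 - q) => w0.
have /andP[q0 q1] := q01; have /andP[b0 b1] := b01; have /andP[ba a1] := ha.
have D0 : 0 < D a := den_gt0 q01 b01 ha.
have a0 := lt_trans b0 ba.
have d0 : 0 < (1 - q) * b * (1 - b) by rewrite !mulr_gt0// subr_gt0.
apply: (@le_trans _ _ (w / D a)); last first.
  by rewrite ler_wpM2l// lef_pV2 ?posrE// den_ge.
rewrite gainE// -/w.
apply: (@le_trans _ _ (b * (1 - a) / (a * D a * (a - b)) * ((a - b) * w))).
  apply: ler_wpM2l; first by rewrite ltW// divr_gt0 ?mulr_gt0 ?subr_gt0.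
  by rewrite gerBl mulr_ge0// ltW// subr_gt0.
have -> : b * (1 - a) / (a * D a * (a - b)) * ((a - b) * w) =
    (b * (1 - a) / a) * (w / D a) by field; lra.
rewrite ler_piMl ?divr_ge0 ?(ltW D0)// ler_pdivrMr//.
have := mulr_gt0 b0 a0; lra.
Qed.

Lemma gain_le0 x a : b < a < 1 -> q * x - (1 - q) <= 0 -> gain x a <= 0.
Proof.
move=> ha w0; have /andP[b0 b1] := b01; have /andP[ba a1] := ha.
have D0 := den_gt0 q01 b01 ha.
have a0 := lt_trans b0 ba.
rewrite gainE// pmulr_rle0; last by rewrite divr_gt0 ?mulr_gt0 ?subr_gt0.
have : (a - b) * (q * x - (1 - q)) <= 0 by rewrite mulr_ge0_le0 ?subr_ge0// ltW.
have : 0 < (1 - a) * b by rewrite mulr_gt0// subr_gt0.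
lra.
Qed.

Lemma gain_near1 x e : 0 < e -> exists a, b < a < 1 /\ - e < gain x a.
Proof.
move=> e0; have /andP[b0 b1] := b01.
have g1 : gain x 1 = 0 by rewrite /gain /A /B /mean_arrival /mean_queue; ring.
have c : {for 1, continuous (gain x)} by apply: gain_continuous; rewrite b1 lexx.
have : \forall u \near (1 : R), - e < gain x u.
  by apply: (cvgr_gt _ c); rewrite g1 oppr_lt0.
by move=> /(near_left b1)[a [ba a1 ga]]; exists a; rewrite ba a1.
Qed.

Lemma sup_eq (I : Type) (F : I -> R) (K : set I) (c m : R) : 0 < c ->
  (forall i, K i -> c * F i <= m) ->
  (forall e, 0 < e -> exists2 i, K i & m - e < c * F i) ->
  c * sup [set F i | i in K] = m.
Proof.
move=> c0 ub app; pose E := [set F i | i in K].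
have [i Ki _] := app 1 ltr01.
have E0 : E !=set0 by exists (F i), i.
have ubE : ubound E (m / c).
  by move=> _ [j Kj <-]; rewrite ler_pdivlMr// mulrC ub.
have hE : has_sup E by split => //; exists (m / c).
apply/eqP; rewrite eq_le; apply/andP; split.
  by rewrite mulrC -ler_pdivlMr//; exact: ge_sup.
apply/ler_addgt0Pr => e e0; have [j Kj le] := app e e0.
rewrite -lerBlDr; apply: le_trans (ltW le) _; rewrite ler_pM2l//.
by apply: (ub_le_sup hE.2); exists j.
Qed.

Lemma formula_alpha x m :
  (forall a, b < a < 1 -> gain x a <= m) ->
  (forall e, 0 < e -> exists a, b < a < 1 /\ m - e < gain x a) ->
  b * sup [set (1 - alpha) / alpha *
      (q * x / (alpha * (1 - b - q) + b * q) - (alpha - b)^-1)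
    | alpha in [set alpha : R | b < alpha < 1]] = m.
Proof.
move=> ub app; have /andP[b0 b1] := b01.
have E a : b < a < 1 -> b * ((1 - a) / a *
    (q * x / (a * (1 - b - q) + b * q) - (a - b)^-1)) = gain x a.
  move=> ha; have D0 := den_gt0 q01 b01 ha; have /andP[ba a1] := ha.
  by rewrite /gain /A /B /mean_arrival /mean_queue; rewrite /den in D0 *; field; lra.
apply: sup_eq => // [a /= ha|e /app[a [ha le]]]; first by rewrite E// ub.
by exists a => //; rewrite E.
Qed.

(** The substitution p = q b (1 - a) / den a, the arrival parameter of the stationary queue, maps
    (b, 1) onto (0, q) and turns the expression into the gain. *)
Lemma formula_p x m :
  (forall a, b < a < 1 -> gain x a <= m) ->
  (forall e, 0 < e -> exists a, b < a < 1 /\ m - e < gain x a) ->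
  (b * q)^-1 * sup [set p * (p * (1 - q) + (q - p) * b) / (1 - p) *
      (x - (1 - q) / (q - p)) | p in [set p : R | 0 < p < q]] = m.
Proof.
move=> ub app; have /andP[b0 b1] := b01; have /andP[q0 q1] := q01.
have E a : b < a < 1 -> let p := q * b * (1 - a) / den q b a in
    0 < p < q /\
    (b * q)^-1 * (p * (p * (1 - q) + (q - p) * b) / (1 - p) *
      (x - (1 - q) / (q - p))) = gain x a.
  move=> ha p; have D0 := den_gt0 q01 b01 ha; have /andP[ba a1] := ha.
  have a0 := lt_trans b0 ba.
  have p1 : 1 - p = a * (1 - b) * (1 - q) / den q b a.
    by rewrite /p /den in D0 *; field; lra.
  have pq : q - p = q * (1 - q) * (a - b) / den q b a.
    by rewrite /p /den in D0 *; field; lra.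
  have pp : p * (1 - q) + (q - p) * b = (1 - q) * q * b * (1 - b) / den q b a.
    by rewrite /p /den in D0 *; field; lra.
  split.
    apply/andP; split; first by rewrite divr_gt0// !mulr_gt0// subr_gt0.
    by rewrite -subr_gt0 pq divr_gt0// !mulr_gt0// subr_gt0.
  rewrite pp p1 pq /p /gain /A /B /mean_arrival /mean_queue.
  move: (den q b a) D0 (denE q b a) => d d0 dE.
  have x' : x - (1 - q) / (q * (1 - q) * (a - b) / d) = x - d / (q * (a - b)).
    by field; lra.
  rewrite x'; field; lra.
have inv p : 0 < p < q -> exists2 a, b < a < 1 & p = q * b * (1 - a) / den q b a.
  move=> /andP[p0 pq].
  (* The substitution is linear in [a] once denominators are cleared; its solution is u / (u +
     v). *)
  pose u := b * q * (1 - p); pose v := p * (1 - q) * (1 - b).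
  have u0 : 0 < u by rewrite !mulr_gt0//; lra.
  have v0 : 0 < v by rewrite !mulr_gt0//; lra.
  have ha : b < u / (u + v) < 1.
    rewrite ltr_pdivlMr ?ltr_pdivrMr ?addr_gt0// mul1r ltrDl v0 andbT.
    have : 0 < b * (1 - b) * (q - p) by rewrite !mulr_gt0//; lra.
    rewrite /u /v; lra.
  exists (u / (u + v)) => //.
  have D0 := den_gt0 q01 b01 ha.
  have dE : den q b (u / (u + v)) = q * b * (1 - b) * (1 - q) / (u + v).
    by rewrite /den; apply: (mulIf (lt0r_neq0 (addr_gt0 u0 v0))); rewrite /u /v; field;
      rewrite -/u -/v; lra.
  rewrite dE; have -> : 1 - u / (u + v) = v / (u + v) by field; lra.
  rewrite /v; field; rewrite -/v; lra.
apply: sup_eq => [|p /= hp|e /app[a [ha le]]]; first by rewrite invr_gt0 mulr_gt0.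
  have [a ha pE] := inv p hp; have [_] := E a ha; rewrite /= -pE => ->.
  exact: ub.
by have [hp EE] := E a ha; eexists; [exact: hp|rewrite EE].
Qed.

End variational.

(** * The time constant *)

Section time_constant.
Context d (T : measurableType d) (R : realType) (P : probability T R).
Variables (q b : R) (S : site -> {RV P >-> R}).
Hypotheses (q01 : 0 < q < 1) (b01 : 0 < b < 1).
Hypothesis hindep : mutually_independent S.
Hypothesis hdist : forall v, ber_geom q b (S v).
Implicit Types (x e m : R) (w : T) (N : nat).

(** The successor counts column 0 along with columns 1 to floor (x N). *)
Definition columns x N : nat := (Num.truncn (x * N%:R)).+1.

Let Y w : site -> nat := fun v => Num.truncn (S v w).

Lemma columns_itv x N : 0 < x ->
  x * N%:R <= (columns x N)%:R <= x * N%:R + 1.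
Proof.
move=> x0; have /truncn_itv/andP[le lt] : 0 <= x * N%:R.
  by rewrite mulr_ge0// ltW.
by rewrite (ltW lt) /columns -natr1 lerD2r.
Qed.

Lemma columns_le x x' N : 0 < x -> x <= x' -> (columns x N <= columns x' N)%N.
Proof.
by move=> x0 xx'; rewrite ltnS; apply: le_truncn; rewrite ler_wpM2r.
Qed.

Lemma ae_reach_ge x a m e : 0 < x -> 0 < e -> b < a < 1 ->
  m - e / 2 < gain q b x a ->
  {ae P, forall w, exists N1, forall N, (N1 <= N)%N ->
    forall c, reach (grid (Y w) (columns x N) N.+1) (columns x N) 0 c ->
    N%:R * (m - e) < c%:R}.
Proof.
move=> x0 e0 ha gm.
have A0 := mean_arrival_ge0 q01 b01 ha; have B0 := mean_queue_ge0 b01 ha.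
(* Deviations cost at most e' (x + 3) N <= e N / 4, bounded terms another e N / 4 from [N0] on, and
   e N / 2 covers the distance from the gain to [m]. *)
pose e' := Num.min 1 (e / 4 / (x + 4)).
have x4 : 0 < x + 4 by lra.
have e'0 : 0 < e' by rewrite lt_min ltr01 !divr_gt0.
have e'1 : e' <= 1 by rewrite ge_min lexx.
have e'x : e' * (x + 4) <= e / 4 by rewrite -ler_pdivlMr// ge_min lexx orbT.
have [t t0 ht] := reach_lower_tail q01 b01 ha e'0.
pose N0 := (Num.truncn ((mean_queue b a + 2) / (e / 4))).+1.
have := @eventually_grid _ _ _ _ _ _ _ q01 b01 hindep hdist (columns x)
  (fun N => [set rows | exists c, reach rows (columns x N) 0 c /\
     c%:R <= N%:R * (m - e)]) 2 (t * e') N0 (mulr_gt0 t0 e'0).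
move=> h; apply: filterS (h _) => [w [N1 hN1]|N N0N].
  exists N1 => N NN c rc; rewrite ltNge; apply/negP => le.
  by apply: (hN1 N NN); exists c.
have N_ge0 : 0 <= N%:R :> R by [].
have y0 : 0 <= e' * N%:R by rewrite mulr_ge0// ltW.
apply: le_trans (le_trans (ht (columns x N) N.+1 _ y0) _); last first.
  rewrite lee_fin -(mulrA t) -[leLHS]mulr_natl -[leRHS]mulrA ler_wpM2l//.
  by rewrite ler_peMl ?expR_ge0// ler1n.
apply: pr_le => rows /= [c [rc le]]; exists c; split => //.
apply: le_trans le _.
have /andP[nx nx1] := columns_itv N x0.
have KN : mean_queue b a + 2 <= e / 4 * N%:R.
  rewrite mulrC -ler_pdivrMr; last lra.
  by apply: (le_trans (ltW (truncnS_gt _))); rewrite ler_nat.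
have h1 := ler_wpM2l (ltW e'0) nx1; have h2 := ler_wpM2r A0 nx.
have h3 := ler_wpM2r N_ge0 e'x; have h4 := ler_wpM2r N_ge0 (ltW gm).
rewrite /gain in h4; rewrite -natr1.
lra.
Qed.

Lemma ae_reach_le_maximizer x a e : 0 < x -> 0 < e -> b < a < 1 ->
  (forall u, b < u < 1 -> gain q b x u <= gain q b x a) ->
  {ae P, forall w, exists N1, forall N, (N1 <= N)%N ->
    exists2 c, reach (grid (Y w) (columns x N) N.+1) (columns x N) 0 c &
      c%:R < N%:R * (gain q b x a + e)}.
Proof.
move=> x0 e0 ha amax.
have [C [t [N0 [t0 ht]]]] := reach_upper_tail q01 b01 x0 ha
  (maximizer_smaller_arrival q01 b01 ha amax)
  (maximizer_larger_queue q01 b01 ha amax) e0.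
have h := @eventually_grid _ _ _ _ _ _ _ q01 b01 hindep hdist (columns x)
  (fun N => [set rows | forall c, reach rows (columns x N) 0 c ->
     N%:R * (gain q b x a + e) <= c%:R]) C t N0 t0.
apply: filterS (h _) => [w [N1 hN1]|N N0N]; last first.
  by apply: ht => //; exact: columns_itv.
exists N1 => N NN; apply: contrapT => no.
apply: (hN1 N NN) => c rc; rewrite leNgt; apply/negP => lt.
by apply: no; exists c.
Qed.

(** The supremum of the gain is described by approximation because it is not attained when q x <= 1
    - q. *)
Definition is_value x m :=
  (forall a, b < a < 1 -> gain q b x a <= m) /\
  (forall e, 0 < e -> exists a, b < a < 1 /\ m - e < gain q b x a).

Lemma ae_reach_le x : 0 < x -> exists2 m, is_value x m &
  forall e, 0 < e ->
  {ae P, forall w, exists N1, forall N, (N1 <= N)%N ->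
    exists2 c, reach (grid (Y w) (columns x N) N.+1) (columns x N) 0 c &
      c%:R < N%:R * (m + e)}.
Proof.
move=> x0; have [q0 q1] := andP q01; have [b0 b1] := andP b01.
have [w0|w0] := ltP 0 (q * x - (1 - q)).
  have [a [ha amax]] := gain_maximizer q01 b01 w0.
  exists (gain q b x a) => [|e e0]; last exact: ae_reach_le_maximizer.
  split => // e e0; exists a; split => //.
  by rewrite gtrBl.
exists 0.
  split => [a ha|e e0]; first exact: gain_le0.
  have [a [ha le]] := gain_near1 q01 b01 x e0.
  by exists a; rewrite sub0r.
(* In the flat regime the bound is inherited from wider rectangles, just above
   the critical slope (1 - q) / q. *)
move=> e e0.
pose d0 := (1 - q) * b * (1 - b).
have d00 : 0 < d0 by rewrite !mulr_gt0// subr_gt0.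
(* Chosen so that [gain_le] bounds the maximal gain at x' by e / 2. *)
pose x' := (e / 2 * d0 + (1 - q)) / q.
have x'E : q * x' - (1 - q) = e / 2 * d0 by rewrite /x'; field; lra.
have ed : 0 < e / 2 * d0 by rewrite mulr_gt0// divr_gt0.
have xx' : x <= x' by rewrite -(ler_pM2l q0); lra.
have x'0 := lt_le_trans x0 xx'.
have w'0 : 0 < q * x' - (1 - q) by rewrite x'E.
have [a [ha amax]] := gain_maximizer q01 b01 w'0.
have ga : gain q b x' a <= e / 2.
  apply: le_trans (gain_le q01 b01 ha (ltW w'0)) _.
  by rewrite x'E -/d0 mulfK// gt_eqF.
have e2 : 0 < e / 2 by rewrite divr_gt0.
apply: filterS (ae_reach_le_maximizer x'0 e2 ha amax) => w [N1 hN1].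
exists N1 => N NN; have [c rc lt] := hN1 N NN.
have [c' c'c rc'] := reach_grid_shrink (columns_le N x0 xx') rc.
exists c' => //; apply: (@le_lt_trans _ _ c%:R); first by rewrite ler_nat.
by apply: lt_le_trans lt _; rewrite ler_wpM2l//; lra.
Qed.

(** The upper and lower bounds hold almost surely for all errors 1 / (k + 1) at once, which squeezes
    the normalized passage time. *)
Lemma ae_time_constant x : 0 < x ->
  exists2 m, is_value x m & is_time_constant S x m.
Proof.
move=> x0; have [m [ub app] up] := ae_reach_le x0; exists m => //.
have inv0 k : 0 < k.+1%:R^-1 :> R by rewrite invr_gt0.
have both : {ae P, forall w, forall k : nat, exists N1, forall N, (N1 <= N)%N ->
    (exists2 c, reach (grid (Y w) (columns x N) N.+1) (columns x N) 0 c &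
      c%:R < N%:R * (m + k.+1%:R^-1)) /\
    forall c, reach (grid (Y w) (columns x N) N.+1) (columns x N) 0 c ->
      N%:R * (m - k.+1%:R^-1) < c%:R}.
  apply: ae_foralln => k.
  have [a [ha ga]] : exists a, b < a < 1 /\ m - k.+1%:R^-1 / 2 < gain q b x a.
    by apply: app; rewrite divr_gt0.
  apply: filterS2 (up _ (inv0 k)) (ae_reach_ge x0 (inv0 k) ha ga).
  move=> w [N1 h1] [N2 h2]; exists (maxn N1 N2) => N.
  by rewrite geq_max => /andP[/h1 ? /h2].
have nat_weights := weights_are_naturals q01 b01 hdist.
rewrite /is_time_constant; apply: filterS2 nat_weights both => w SY h.
apply/cvgrPdist_le => /= e e0.
(* This index k satisfies 1 / (k + 1) <= e. *)
have [N1 hN1] := h (Num.truncn e^-1).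
near=> N.
have N0 : (0 < N)%N by near: N; exact: nbhs_infty_gt.
have NN1 : (N1 <= N)%N by near: N; exact: nbhs_infty_ge.
have [[c rc ltc] gec] := hN1 N NN1.
have e1 : (Num.truncn e^-1).+1%:R^-1 <= e.
  by rewrite invf_ple ?posrE// ltW// truncnS_gt.
have -> : Num.floor (x * N%:R) = (Num.truncn (x * N%:R))%:Z.
  have xN : 0 <= x * N%:R by rewrite mulr_ge0// ltW.
  by rewrite truncn_floor xN gez0_abs// floor_ge0.
have [[c' rc' fE] fle] := @fpt_reach R (Y w) (fun v => S v w) SY
  (Num.truncn (x * N%:R)) N.
have Nr : 0 < N%:R :> R by rewrite ltr0n.
have c'c : c'%:R < N%:R * (m + (Num.truncn e^-1).+1%:R^-1).
  by apply: le_lt_trans ltc; rewrite -fE fle.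
have ltc' := gec _ rc'.
rewrite fE ler_distlC (mulrC N%:R^-1) ler_pdivlMr// ler_pdivrMr//.
have h1 := ler_wpM2l (ltW Nr) e1.
move: (_.+1%:R^-1) h1 ltc' c'c => k h1 ltc' c'c.
by apply/andP; split; lra.
Unshelve. all: by end_near.
Qed.

End time_constant.

Theorem mainTheorem4 (d : measure_display) (T : measurableType d)
    (R : realType) (P : probability T R) (q beta : R)
    (S : int * int -> {RV P >-> R})
    (hq : 0 < q < 1) (hbeta : 0 < beta < 1)
    (hindep : mutually_independent S)
    (hdist : forall v : int * int, ber_geom q beta (S v)) :
  exists f : R -> R, forall x : R, 0 < x ->
    [/\ is_time_constant S x (f x),
        f x = (beta * q)^-1 *
          sup [set p * (p * (1 - q) + (q - p) * beta) / (1 - p) *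
                   (x - (1 - q) / (q - p))
              | p in [set p : R | 0 < p < q]]
      & f x = beta *
          sup [set (1 - alpha) / alpha *
                   (q * x / (alpha * (1 - beta - q) + beta * q) -
                    (alpha - beta)^-1)
              | alpha in [set alpha : R | beta < alpha < 1]] ].
Proof.
exists (fun x => beta * sup [set (1 - alpha) / alpha *
   (q * x / (alpha * (1 - beta - q) + beta * q) - (alpha - beta)^-1)
   | alpha in [set alpha : R | beta < alpha < 1]]) => x x0.
have [m [ub app] lim] := ae_time_constant hq hbeta hindep hdist x0.
have alphaE := formula_alpha hq hbeta ub app.
by split=> //; rewrite alphaE// (formula_p hq hbeta ub app).
Qed.
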